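(* The map $X \mapsto \operatorname{Age}_{cl}(X)$ induces a bijection between the collection of all guarded Fraïssé Banach spaces (considered up to linear isometry) and the collection of all guarded Fraïssé classes of finite-dimensional normed spaces.
   Context: All Banach spaces are real. For $C \geq 0$, $\operatorname{Emb}_C(Y,Z)$ is the set of bounded linear operators $T\colon Y\to Z$ with $e^{-C}\|y\| \le \|Ty\| \le e^{C}\|y\|$ for all $y$; $\operatorname{Emb}(Y,Z)=\operatorname{Emb}_0(Y,Z)$. $\operatorname{Iso}(X)$ is the group of surjective linear isometries of $X$. $\operatorname{BM}$ is the set of isometry classes of finite-dimensional real normed spaces, topologized as the disjoint union over $n$ of the sets $\operatorname{BM}_n$ of isometry classes of $n$-dimensional spaces, each with the metric $d_{\operatorname{BM}}(E,F)=\inf\{\log(\|T\|\|T^{-1}\|) : T\colon E\to F \text{ isomorphism}\}$. Elements of $\operatorname{BM}$ are identified with actual spaces. $\operatorname{Age}(X)\subseteq\operatorname{BM}$ is the set of finite-dimensional spaces isometric to a subspace of $X$; $\operatorname{Age}_{cl}(X)$ is its closure in $\operatorname{BM}$. A separable Banach space $X$ (finite- or infinite-dimensional) is guarded Fraïssé if it satisfies one of the following two equivalent properties: (gF-1) for every finite-dimensional subspace $E\subseteq X$ and every $\varepsilon>0$ there exist $\delta>0$ and a finite-dimensional subspace $F\subseteq X$ with $E\subseteq F$ such that for all $\iota,\iota'\in\operatorname{Emb}_\delta(F,X)$ there is $T\in\operatorname{Iso}(X)$ with $\|\iota'|_E-T\circ\iota|_E\|<\varepsilon$; (gF-2) for every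 finite-dimensional subspace $E\subseteq X$ and every $\varepsilon>0$ there exist $F\in\operatorname{Age}_{cl}(X)$, $\phi\in\operatorname{Emb}_\varepsilon(E,F)$ and $\delta>0$ such that for every $G\in\operatorname{Age}_{cl}(X)$, $\psi\in\operatorname{Emb}_\delta(F,G)$ and $\eta>0$ there is $\iota\in\operatorname{Emb}_\eta(G,X)$ with $\|\operatorname{Id}_E-\iota\circ\psi\circ\phi\|<\varepsilon$. A class $\mathcal K\subseteq\operatorname{BM}$ is a guarded Fraïssé class if it is nonempty, closed in $\operatorname{BM}$, and satisfies: (HP) (hereditary) if $F\in\mathcal K$ and $E\in\operatorname{BM}$ embeds isometrically into $F$, then $E\in\mathcal K$; (JEP) for all $F,G\in\mathcal K$ there is $H\in\mathcal K$ into which both $F$ and $G$ embed isometrically; (GAP) for every $E\in\mathcal K$ and $\varepsilon>0$ there exist $F\in\mathcal K$, $\phi\in\operatorname{Emb}_\varepsilon(E,F)$ and $\delta>0$ such that for all $G,H\in\mathcal K$, $\psi_G\in\operatorname{Emb}_\delta(F,G)$, $\psi_H\in\operatorname{Emb}_\delta(F,H)$ there exist $K\in\mathcal K$, $\iota_G\in\operatorname{Emb}(G,K)$, $\iota_H\in\operatorname{Emb}(H,K)$ with $\|\iota_G\circ\psi_G\circ\phi-\iota_H\circ\psi_H\circ\phi\|<\varepsilon$. *)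

(* Defs.v *)
From HB Require Import structures.
From mathcomp Require Import all_boot all_order all_algebra.
From mathcomp Require Import all_classical all_reals all_analysis.

Set Implicit Arguments.
Unset Strict Implicit.
Unset Printing Implicit Defensive.

Import Order.TTheory GRing.Theory Num.Theory.
Import numFieldNormedType.Exports.

Local Open Scope classical_set_scope.
Local Open Scope ring_scope.

Section Operators.
Context {R : realType}.

(* Only used on bounded maps that vanish at 0, where the supremum is genuine. *)
Definition opnorm (Y Z : normedModType R) (f : Y -> Z) : R :=
  sup [set `|f y| | y in [set y : Y | `|y| <= 1]].

(* The upper bound makes T bounded; Emb(Y, Z) is the case C = 0. *)
Definition is_emb (Y Z : normedModType R) (C : R) (T : {linear Y -> Z}) : Prop :=
  forall y, expR (- C) * `|y| <= `|T y| <= expR C * `|y|.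

Definition is_surj_isometry (Y Z : normedModType R) (T : {linear Y -> Z}) : Prop :=
  (forall y, `|T y| = `|y|) /\ (forall z, exists y, T y = z).

Definition isometric (Y Z : normedModType R) : Prop :=
  exists T : {linear Y -> Z}, is_surj_isometry T.

Definition has_dim (V : normedModType R) (n : nat) : Prop :=
  exists f : {linear V -> 'rV[R]_n}, bijective f.

Definition finite_dim (V : normedModType R) : Prop := exists n, has_dim V n.

End Operators.

Section Subspaces.
Context {R : realType} (X : normedModType R).

Record linSubspace := LinSubspace {
  subspace_pred :> {pred X};
  subspaceP : submod_closed subspace_pred
}.

HB.instance Definition _ (V : linSubspace) :=
  GRing.isSubmodClosed.Build R X (subspace_pred V) (subspaceP V).

Section SubspaceType.
Variable V : linSubspace.

Definition subspace_type : Type := {x : X | x \in subspace_pred V}.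

HB.instance Definition _ := SubChoice.on subspace_type.
HB.instance Definition _ := [SubChoice_isSubLmodule of subspace_type by <:].

Let normV (x : subspace_type) : R := `|val x|.

Let normVD x y : normV (x + y) <= normV x + normV y.
Proof. exact: ler_normD. Qed.

Let normVZ (l : R) x : normV (l *: x) = `|l| * normV x.
Proof. exact: normrZ. Qed.

Let normV0 x : normV x = 0 -> x = 0.
Proof. by move=> /normr0_eq0 x0; exact: val_inj. Qed.

HB.instance Definition _ :=
  Lmodule_isNormed.Build R subspace_type normVD normVZ normV0.

End SubspaceType.

End Subspaces.

(* A point of BM is represented by an actual space, isometric spaces being the
   same point: a subset of BM is a predicate that satisfies [bm_set]. It is not
   a [set] of spaces, because [set] lives in too low a universe. *)
Record fdNormed (R : realType) := FdNormed {
  fd_space :> normedModType R;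
  fd_finite_dim : finite_dim fd_space
}.

Record fdSubspace (R : realType) (X : normedModType R) := FdSubspace {
  fds_subspace :> linSubspace X;
  fds_finite_dim : finite_dim (subspace_type fds_subspace : normedModType R)
}.

Definition fds_space (R : realType) (X : normedModType R) (E : fdSubspace X) :
    fdNormed R :=
  FdNormed (fds_finite_dim E).

Definition fds_incl (R : realType) (X : normedModType R) (E : fdSubspace X)
  (x : fds_space E) : X := sval x.

Section BanachMazur.
Context {R : realType}.
Implicit Types (E F : fdNormed R) (K : fdNormed R -> Prop).

(* Only used for spaces of the same dimension, as otherwise the set is empty.
   In dimension 0, the value is inf {ln 0} = 0. *)
Definition dBM E F : R :=
  inf [set r | exists (T : {linear E -> F}) (S : {linear F -> E}),
    [/\ cancel T S, cancel S T & r = ln (opnorm T * opnorm S)]].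

Definition bm_set K : Prop := forall E F, isometric E F -> K E -> K F.

(* Closure in the disjoint union over n of the metric spaces (BM_n, dBM). *)
Definition bm_closure K : fdNormed R -> Prop := fun E =>
  forall e : R, 0 < e -> exists F n,
    [/\ K F, has_dim E n, has_dim F n & dBM E F < e].

Definition age (X : normedModType R) : fdNormed R -> Prop := fun E =>
  exists V : fdSubspace X, isometric E (fds_space V).

Definition age_cl (X : normedModType R) : fdNormed R -> Prop :=
  bm_closure (age X).

End BanachMazur.

Section GuardedFraisse.
Context {R : realType}.

Definition separable (X : topologicalType) : Prop :=
  exists2 D : set X, countable D & dense D.

Definition gF1 (X : normedModType R) : Prop :=
  forall (E : fdSubspace X) (eps : R), 0 < eps ->
  exists (delta : R) (F : fdSubspace X)
    (EF : forall x : X, x \in subspace_pred E -> x \in subspace_pred F),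
    0 < delta /\
    forall iota iota' : {linear fds_space F -> X},
      is_emb delta iota -> is_emb delta iota' ->
      exists T : {linear X -> X}, is_surj_isometry T /\
        opnorm (fun x : fds_space E =>
          let y : fds_space F := exist _ (sval x) (EF _ (svalP x)) in
          iota' y - T (iota y)) < eps.

Definition gF2 (X : normedModType R) : Prop :=
  forall (E : fdSubspace X) (eps : R), 0 < eps ->
  exists (F : fdNormed R) (phi : {linear fds_space E -> F}) (delta : R),
    [/\ age_cl X F, is_emb eps phi, 0 < delta &
    forall (G : fdNormed R) (psi : {linear F -> G}) (eta : R),
      age_cl X G -> is_emb delta psi -> 0 < eta ->
      exists iota : {linear G -> X}, is_emb eta iota /\
        opnorm (fun x : fds_space E => fds_incl x - iota (psi (phi x))) < eps].

(* gF1 and gF2 are equivalent for separable Banach spaces; either of them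
   qualifies X. *)
Definition guarded_fraisse (X : completeNormedModType R) : Prop :=
  separable X /\ (gF1 X \/ gF2 X).

Definition HP (K : fdNormed R -> Prop) : Prop :=
  forall E F : fdNormed R, K F ->
  (exists T : {linear E -> F}, is_emb 0 T) -> K E.

Definition JEP (K : fdNormed R -> Prop) : Prop :=
  forall F G : fdNormed R, K F -> K G ->
  exists H : fdNormed R, [/\ K H,
    exists T : {linear F -> H}, is_emb 0 T &
    exists T : {linear G -> H}, is_emb 0 T].

Definition GAP (K : fdNormed R -> Prop) : Prop :=
  forall (E : fdNormed R) (eps : R), K E -> 0 < eps ->
  exists (F : fdNormed R) (phi : {linear E -> F}) (delta : R),
    [/\ K F, is_emb eps phi, 0 < delta &
    forall (G H : fdNormed R) (psiG : {linear F -> G}) (psiH : {linear F -> H}),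
      K G -> K H -> is_emb delta psiG -> is_emb delta psiH ->
      exists (L : fdNormed R) (iotaG : {linear G -> L}) (iotaH : {linear H -> L}),
        [/\ K L, is_emb 0 iotaG, is_emb 0 iotaH &
        opnorm (fun x : E => iotaG (psiG (phi x)) - iotaH (psiH (phi x))) < eps]].

Record guarded_fraisse_class (K : fdNormed R -> Prop) : Prop := {
  gfc_bm_set : bm_set K;
  gfc_nonempty : exists E, K E;
  gfc_closed : forall E, bm_closure K E -> K E;
  gfc_HP : HP K;
  gfc_JEP : JEP K;
  gfc_GAP : GAP K
}.

End GuardedFraisse.

(* Main.v *)
From HB Require Import structures.
Require Import Defs.
From mathcomp Require Import all_boot all_order all_algebra.
From mathcomp Require Import all_classical all_reals all_analysis.
From mathcomp Require Import lra.

(** The map from guarded Fraisse spaces to guarded Fraisse classes rests on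
    property (gF-2). Property (gF-1) implies it ([gF1_gF2]), so it may be assumed of
    every guarded Fraisse space. Membership in the closed age is used in the
    following form only: [E] belongs to it iff for every [e > 0] there is an
    embedding of [E] into [X] of distortion at most [e] ([age_clP]).

    The closed age is a guarded class ([gF2_class]). Joint embedding and guarded
    amalgamation are the properties that need an argument. In both cases, the
    spaces [G] and [H] to be amalgamated have embeddings [i_n] and [j_n] into [X]
    whose distortion tends to 0 and which nearly agree on a common part. The limit
    of the seminorms [`|i_n g + j_n h|] on [G * H] along an ultrafilter, divided by
    its kernel, is the amalgam ([ultra_amalgam]); it lies in the closed age because
    pointwise convergence of norms on a finite-dimensional space is uniform
    ([pointwise_emb]).

    The closed age determines the space ([gF2_isometric]). If [X] and [Y] have the
    same closed age, the guards of finite-dimensional subspaces of [X] embed in [Y]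
    and conversely. Going back and forth yields a tower of finite-dimensional spaces
    with maps to [X] and to [Y] that commute with the tower up to summable errors
    and whose ranges are dense in the limit; and two limits of one tower are
    isometric ([tower_limit_unique]).

    Every guarded class [K] is the closed age of a guarded space
    ([fraisse_limit]). Build a tower in [K] in which each space guards the previous
    one, and in which all extension problems over each guard are solved, by
    amalgamation, at infinitely many stages. Countably many problems suffice: a
    norm is known up to small distortion from finitely many rounded values, so that
    the extensions of a given space inside [K] form a separable family
    ([countable_extensions]). The limit of the tower is the space of sequences that
    are Cauchy along the tower, modulo null sequences ([tower_limit_exists]). The
    solved problems say precisely that the spaces of the tower are guards in the
    sense of (gF-2), and that every member of [K] is almost embedded in the
    limit. *)

Set Implicit Arguments.
Unset Strict Implicit.
Unset Printing Implicit Defensive.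

Import Order.TTheory GRing.Theory Num.Theory Num.Def.
Import numFieldNormedType.Exports.

Local Open Scope classical_set_scope.
Local Open Scope ring_scope.

(** * Normed quotients of seminormed spaces *)

Section Seminorms.
Context {R : realType}.

Record seminorm (W : lmodType R) := Seminorm {
  sn :> W -> R;
  snD : forall x y, sn (x + y) <= sn x + sn y;
  snZ : forall a x, sn (a *: x) = `|a| * sn x
}.

Section Theory.
Variables (W : lmodType R) (N : seminorm W).

Lemma sn0 : N 0 = 0.
Proof. by rewrite -(scale0r 0) snZ normr0 mul0r. Qed.

Lemma snN x : N (- x) = N x.
Proof. by rewrite -scaleN1r snZ normrN normr1 mul1r. Qed.

Lemma snB x y : N (x - y) <= N x + N y.
Proof. by rewrite (le_trans (snD _ _ _)) // snN. Qed.

Lemma sn_ge0 x : 0 <= N x.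
Proof. by have := snB x x; rewrite subrr sn0 -mulr2n pmulrn_lge0. Qed.

Lemma sn_dist x y : `|N x - N y| <= N (x - y).
Proof.
have h a b : N a - N b <= N (a - b).
  by rewrite lerBlDr; have := snD N (a - b) b; rewrite subrK.
by rewrite ler_norml lerNl opprB h -[N (x - y)]snN opprB h.
Qed.

Lemma sn_eq x y : N (x - y) = 0 -> N x = N y.
Proof.
move=> h; apply/eqP; rewrite -subr_eq0 -normr_le0 -h; exact: sn_dist.
Qed.

Lemma sn_sum I (r : seq I) (P : pred I) (F : I -> W) :
  N (\sum_(i <- r | P i) F i) <= \sum_(i <- r | P i) N (F i).
Proof.
elim/big_ind2: _ => [|x1 x2 y1 y2 h1 h2|//]; first by rewrite sn0.
exact: le_trans (snD _ _ _) (lerD h1 h2).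
Qed.

Definition null_pred : {pred W} := [pred x | N x == 0].

Lemma null_zmod : zmod_closed null_pred.
Proof.
split=> [|x y /eqP Nx /eqP Ny]; first by rewrite inE sn0.
by rewrite inE eq_le sn_ge0 andbT (le_trans (snB _ _)) // Nx Ny addr0.
Qed.

HB.instance Definition _ := GRing.isZmodClosed.Build W null_pred null_zmod.

(** Amalgams and limits of towers come with a seminorm only; this quotient is what
    turns them into normed spaces. *)
Definition squot : Type := Quotient.quot null_pred.
HB.instance Definition _ := GRing.Zmodule.on squot.

Definition sproj (w : W) : squot := \pi_(Quotient.quot null_pred)%qT w.
Definition srepr (q : squot) : W := repr (q : Quotient.quot null_pred).

Lemma sreprK : cancel srepr sproj.
Proof. by move=> q; rewrite /sproj /srepr reprK. Qed.

Lemma sproj_eq w v : sproj w = sproj v <-> N (w - v) = 0.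
Proof.
rewrite /sproj; split=> [/eqP|h].
  by rewrite -Quotient.idealrBE inE => /eqP.
by apply/eqP; rewrite -Quotient.idealrBE inE h.
Qed.

Lemma sn_sreprK w : N (srepr (sproj w)) = N w.
Proof. by apply: sn_eq; apply/sproj_eq; rewrite sreprK. Qed.

Lemma sprojD w v : sproj (w + v) = sproj w + sproj v.
Proof. exact: (raddfD \pi_(Quotient.quot null_pred)%qT). Qed.

Definition sscale (a : R) (q : squot) : squot := sproj (a *: srepr q).

Lemma sprojZ a w : sproj (a *: w) = sscale a (sproj w).
Proof.
apply/sproj_eq; rewrite -scalerBr snZ.
by have /sproj_eq -> := esym (sreprK (sproj w)); rewrite mulr0.
Qed.

Let sscaleA a b q : sscale a (sscale b q) = sscale (a * b) q.
Proof. by rewrite -(sreprK q) -!sprojZ scalerA. Qed.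

Let sscale1 : left_id 1 sscale.
Proof. by move=> q; rewrite -(sreprK q) -!sprojZ scale1r. Qed.

Let sscaleDr : right_distributive sscale +%R.
Proof.
by move=> a p q; rewrite -(sreprK p) -(sreprK q) -sprojD -!sprojZ scalerDr sprojD.
Qed.

Let sscaleDl q : {morph sscale^~ q : a b / a + b}.
Proof. by move=> a b; rewrite /= -(sreprK q) -!sprojZ scalerDl sprojD. Qed.

HB.instance Definition _ :=
  GRing.Zmodule_isLmodule.Build R squot sscaleA sscale1 sscaleDr sscaleDl.

Let snorm (q : squot) : R := N (srepr q).

Let snorm_proj w : snorm (sproj w) = N w.
Proof. exact: sn_sreprK. Qed.

Let snormD p q : snorm (p + q) <= snorm p + snorm q.
Proof. by rewrite -(sreprK p) -(sreprK q) -sprojD !snorm_proj snD. Qed.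

Let snormZ a q : snorm (a *: q) = `|a| * snorm q.
Proof. by rewrite -{1}(sreprK q) -[a *: _]sprojZ snorm_proj snZ. Qed.

Let snorm0 q : snorm q = 0 -> q = 0.
Proof.
have -> : 0 = sproj 0 by have := sprojD 0 0; rewrite addr0 -{1}[sproj 0]addr0 => /addrI.
by move=> h; rewrite -(sreprK q); apply/sproj_eq; rewrite subr0.
Qed.

HB.instance Definition _ :=
  Lmodule_isNormed.Build R squot snormD snormZ snorm0.

Lemma sproj_linear : linear sproj.
Proof. by move=> a u v; rewrite sprojD sprojZ. Qed.
HB.instance Definition _ := GRing.isLinear.Build R W squot _ sproj sproj_linear.

Lemma norm_sproj w : `|sproj w| = N w.
Proof. exact: sn_sreprK. Qed.

Lemma sproj_surj (q : squot) : exists w, sproj w = q.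
Proof. by exists (srepr q); rewrite sreprK. Qed.

End Theory.
End Seminorms.

(** * Finite-dimensional normed spaces *)

Section FiniteDimension.
Context {R : realType}.

Definition mklin (V W : lmodType R) (f : V -> W) (h : linear f) : {linear V -> W} :=
  HB.pack f (GRing.isLinear.Build R V W _ f h).

Section LinComb.
Variables (W : lmodType R) (n : nat) (w : 'I_n -> W).

Definition lincomb (v : 'rV[R]_n) : W := \sum_i v 0 i *: w i.

Lemma lincomb_linear : linear lincomb.
Proof.
move=> a u v; rewrite /lincomb scaler_sumr -big_split; apply: eq_bigr => i _ /=.
by rewrite !mxE scalerDl scalerA.
Qed.
HB.instance Definition _ :=
  GRing.isLinear.Build R 'rV[R]_n W _ lincomb lincomb_linear.

Lemma lincombE v : lincomb v = \sum_i v 0 i *: w i. Proof. by []. Qed.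

Lemma lincomb_delta i : lincomb (delta_mx 0 i) = w i.
Proof.
rewrite /lincomb (bigD1 i) //= mxE !eqxx scale1r big1 ?addr0 // => j ji.
by rewrite mxE (negbTE ji) scale0r.
Qed.

End LinComb.

Lemma linear_rowE (W : lmodType R) n (T : {linear 'rV[R]_n -> W}) v :
  T v = lincomb (fun i => T (delta_mx 0 i)) v.
Proof.
rewrite lincombE {1}[v]row_sum_delta linear_sum; apply: eq_bigr => i _.
by rewrite linearZ.
Qed.

Lemma row_coord_le n (v : 'rV[R]_n) i : `|v 0 i| <= `|v|.
Proof.
by rewrite [leRHS]/normr /= mx_normrE; apply/bigmax_geP; right; exists (0, i).
Qed.

Lemma row_norm_le n (v : 'rV[R]_n) c :
  0 <= c -> (forall i, `|v 0 i| <= c) -> `|v| <= c.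
Proof.
move=> c0 h; rewrite [leLHS]/normr /= mx_normrE; apply/bigmax_leP; split=> //.
by move=> [i j] _ /=; rewrite (ord1 i).
Qed.

Lemma seminorm_row_bounded n (N : seminorm 'rV[R]_n) v :
  N v <= (\sum_i N (delta_mx 0 i)) * `|v|.
Proof.
rewrite {1}[v]row_sum_delta (le_trans (sn_sum _ _ _ _)) // mulr_suml.
by apply: ler_sum => i _; rewrite snZ mulrC ler_wpM2l ?sn_ge0 ?row_coord_le.
Qed.

Lemma comp_seminorm_subproof (V W : lmodType R) (T : {linear V -> W}) (N : seminorm W) :
  (forall x y, N (T (x + y)) <= N (T x) + N (T y)) *
  (forall a x, N (T (a *: x)) = `|a| * N (T x)).
Proof. by split=> [x y|a x]; rewrite ?linearD ?linearZ ?snD ?snZ. Qed.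

Definition comp_seminorm V W T N : seminorm V :=
  Seminorm (@comp_seminorm_subproof V W T N).1 (comp_seminorm_subproof T N).2.

Definition norm_seminorm (V : normedModType R) : seminorm V :=
  Seminorm (@ler_normD R V) (@normrZ R V).

Definition lin_seminorm (V : lmodType R) (W : normedModType R) (T : {linear V -> W}) :
  seminorm V := comp_seminorm T (norm_seminorm W).

Lemma lin_seminormE (V : lmodType R) (W : normedModType R) (T : {linear V -> W}) v :
  lin_seminorm T v = `|T v|.
Proof. by []. Qed.

Lemma linear_row_bounded (W : normedModType R) n (T : {linear 'rV[R]_n -> W}) v :
  `|T v| <= (\sum_i `|T (delta_mx 0 i)|) * `|v|.
Proof. exact: (seminorm_row_bounded (lin_seminorm T)). Qed.

Lemma linear_row_continuous (W : normedModType R) n (T : {linear 'rV[R]_n -> W}) :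
  continuous T.
Proof.
apply/linear_bounded_continuous/linear_boundedP; near=> r => v.
apply: le_trans (linear_row_bounded T v) _.
by rewrite ler_wpM2r //; near: r; apply: nbhs_pinfty_ge; rewrite num_real.
Unshelve. all: by end_near. Qed.

(** By compactness of the unit sphere, [`|T v|] attains on it a minimum, which is
    positive because [T] is injective. *)
Lemma injective_row_below (W : normedModType R) n (T : {linear 'rV[R]_n -> W}) :
  injective T -> exists2 c, 0 < c & forall v, c * `|v| <= `|T v|.
Proof.
move=> Tinj; case: n T Tinj => [|n] T Tinj.
  exists 1 => // v; rewrite mul1r.
  have -> : v = 0 by apply/rowP => -[].
  by rewrite linear0 !normr0.
pose S : set 'rV[R]_n.+1 := [set v | `|v| = 1].
have S0 : S !=set0.
  exists (const_mx 1); rewrite /S /=; apply/eqP; rewrite eq_le; apply/andP; split.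
    by apply: row_norm_le => // i; rewrite mxE normr1.
  have := row_coord_le (const_mx 1 : 'rV[R]_n.+1) 0. by rewrite mxE normr1.
have cS : compact S.
  apply: bounded_closed_compact.
    exists 1; split=> [|x x1 v]; first exact: num_real.
    by rewrite /S /= => ->; exact: ltW.
  have -> : S = (fun v : 'rV[R]_n.+1 => `|v|) @^-1` [set 1] by [].
  apply: preimage_closed; last exact: closed_eq.
  by move=> x _; exact: norm_continuous.
have cT : {within S, continuous (fun v => `|T v|)}.
  apply: continuous_subspaceT => v.
  apply: (@continuous_comp _ _ _ T (fun w : W => `|w|)).
    exact: linear_row_continuous.
  exact: norm_continuous.
have [u] := EVT_min_rV S0 cS cT; rewrite inE => uS umin.
exists `|T u|.
  rewrite normr_gt0; apply/eqP => Tu0.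
  have u0 : u = 0 by apply: Tinj; rewrite Tu0 linear0.
  by move: uS; rewrite /S /= u0 normr0 => /eqP; rewrite eq_sym oner_eq0.
move=> v; have [->|v0] := eqVneq v 0; first by rewrite linear0 !normr0 mulr0.
have nv : 0 < `|v| by rewrite normr_gt0.
have := umin (`|v|^-1 *: v); rewrite inE linearZ /= !normrZ normfV normr_id.
by rewrite /S /= normrZ normfV normr_id mulVf ?gt_eqF // ler_pdivlMl // mulrC; apply.
Qed.

Lemma has_dim_iso (V : normedModType R) n : has_dim V n ->
  exists (f : {linear V -> 'rV[R]_n}) (g : {linear 'rV[R]_n -> V}),
    cancel f g /\ cancel g f.
Proof.
move=> [f [g fg gf]]; have lg : linear g.
  by move=> a u v; rewrite -{1}(gf u) -{1}(gf v) -linearP fg.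
by exists f, (mklin lg).
Qed.

Lemma row_section (Q : lmodType R) n (s : {linear 'rV[R]_n -> Q}) (W : lmodType R)
    (p : {linear W -> Q}) : (forall q, exists w, p w = q) ->
  exists t : {linear 'rV[R]_n -> W}, forall v, p (t v) = s v.
Proof.
move=> ps; pose w i := projT1 (cid (ps (s (delta_mx 0 i)))).
exists (lincomb w) => v; rewrite [RHS]linear_rowE !lincombE linear_sum.
by apply: eq_bigr => i _; rewrite linearZ /w; case: cid => x /= ->.
Qed.

Lemma fd_section (V : normedModType R) (W : lmodType R) (p : {linear W -> V}) :
  finite_dim V -> (forall v, exists w, p w = v) ->
  exists t : {linear V -> W}, forall v, p (t v) = v.
Proof.
move=> [n /has_dim_iso [f [g [fg gf]]]] ps.
have [t ht] := row_section g ps.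
by exists (t \o f) => v; rewrite /= ht fg.
Qed.

Lemma row_injective_dim m n (T : {linear 'rV[R]_m -> 'rV[R]_n}) :
  injective T -> (m <= n)%N.
Proof.
move=> Tinj; have rT : row_free (lin1_mx T).
  rewrite -kermx_eq0 -submx0; apply/rV_subP => v /sub_kermxP.
  rewrite mul_rV_lin1 => Tv; rewrite submx0; apply/eqP/Tinj.
  by rewrite Tv linear0.
by rewrite -(eqP rT) rank_leq_col.
Qed.

(** Take an injective map from a row space into [Q] whose source has the largest
    possible dimension. It is onto: a vector outside its range would give an
    injective map from a row space of one more dimension. *)
Lemma fd_of_surj (Q : normedModType R) n (s : {linear 'rV[R]_n -> Q}) :
  (forall q, exists v, s v = q) -> finite_dim Q.
Proof.
move=> ss.
pose P m := `[< exists t : {linear 'rV[R]_m -> Q}, injective t >].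
have P0 : P 0%N.
  apply/asboolP; exists (lincomb (fun _ => 0)) => u v _.
  by apply/rowP => -[].
(* an injective map into Q lifts through s to an injective map into 'rV_n *)
have Pn m : P m -> (m <= n)%N.
  move=> /asboolP [t tinj]; have [u us] := row_section t ss.
  by apply: (@row_injective_dim m n u) => x y /(congr1 s); rewrite !us => /tinj.
have [m /asboolP [t tinj] mmax] := ex_maxnP (ex_intro P _ P0) Pn.
exists m; have tsurj q : exists v, t v = q.
  apply: contrapT => nq.
  have : P (m + 1)%N; last by move=> /mmax; rewrite addn1 ltnn.
  apply/asboolP.
  pose w (v : 'rV[R]_(m + 1)) : Q := t (lsubmx v) + rsubmx v 0 0 *: q.
  have lw : linear w.
    move=> a u v; rewrite /w !linearP !mxE scalerDl scalerDr addrACA.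
    by rewrite scalerA.
  pose W : {linear 'rV[R]_(m + 1) -> Q} := mklin lw.
  exists W; apply: raddf_inj => v; rewrite /W /= /w => wv.
  have r0 : rsubmx v 0 0 = 0.
    apply/eqP/negP => /negP r0; apply: nq.
    exists (- (rsubmx v 0 0)^-1 *: lsubmx v).
    move/eqP: wv; rewrite addr_eq0 => /eqP tv; rewrite linearZ /= tv.
    by rewrite scalerN scaleNr opprK scalerA mulVf // scale1r.
  move: wv; rewrite r0 scale0r addr0 => tv.
  have l0 : lsubmx v = 0 by apply: tinj; rewrite tv linear0.
  rewrite -[v]hsubmxK l0.
  have -> : rsubmx v = 0 by apply/rowP => i; rewrite (ord1 i) r0 mxE.
  by rewrite row_mx0.
pose g q := projT1 (cid (tsurj q)).
have tg : cancel g t by move=> q; rewrite /g; case: cid.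
have gt : cancel t g by move=> v; apply: tinj; rewrite tg.
have lg : linear g by move=> a u v; apply: tinj; rewrite tg linearP !tg.
exists (mklin lg).
by exists t.
Qed.

Lemma fd_param (Q : normedModType R) : finite_dim Q ->
  exists n (s : {linear 'rV[R]_n -> Q}), bijective s.
Proof.
by move=> [n /has_dim_iso [f [g [fg gf]]]]; exists n, g; exists f.
Qed.

Lemma fd_linear_image (V : normedModType R) (Q : normedModType R) (p : {linear V -> Q}) :
  finite_dim V -> (forall q, exists v, p v = q) -> finite_dim Q.
Proof.
move=> /fd_param [n [s [s' _ ss']]] ps.
apply: (@fd_of_surj Q n (p \o s)) => q; have [v <-] := ps q.
by exists (s' v); rewrite /= ss'.
Qed.

Lemma fd_row n : finite_dim 'rV[R]_n.
Proof. by exists n; exists idfun; exists idfun. Qed.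

Lemma fd_bounded (V W : normedModType R) (T : {linear V -> W}) : finite_dim V ->
  exists2 C, 0 < C & forall v, `|T v| <= C * `|v|.
Proof.
move=> /fd_param [n [s [s' s's ss']]].
have [c c0 hc] := injective_row_below (can_inj s's).
set M := \sum_i `|(T \o s) (delta_mx 0 i)|.
have M0 : 0 <= M by apply: sumr_ge0.
exists ((M + 1) / c) => [|v]; first by rewrite divr_gt0 // ltr_wpDl.
rewrite -(ss' v); have := linear_row_bounded (T \o s) (s' v).
rewrite -/M /= => /le_trans; apply.
apply: le_trans (_ : (M + 1) * `|s' v| <= _); first by rewrite ler_wpM2r // lerDl.
by rewrite -mulrA ler_wpM2l ?addr_ge0 // ler_pdivlMl.
Qed.

End FiniteDimension.

(** * Almost isometric embeddings and the closed age *)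

Section Operators.
Context {R : realType}.

Lemma emb_le (Y Z : normedModType R) (C D : R) (T : {linear Y -> Z}) :
  C <= D -> is_emb C T -> is_emb D T.
Proof.
move=> CD h y; have /andP[h1 h2] := h y; apply/andP; split.
  by apply: le_trans h1; rewrite ler_wpM2r // ler_expR lerN2.
by apply: (le_trans h2); rewrite ler_wpM2r // ler_expR.
Qed.

Lemma emb_ub (Y Z : normedModType R) (C : R) (T : {linear Y -> Z}) y :
  is_emb C T -> `|T y| <= expR C * `|y|.
Proof. by move=> /(_ y) /andP[]. Qed.

Lemma emb_lb (Y Z : normedModType R) (C : R) (T : {linear Y -> Z}) y :
  is_emb C T -> `|y| <= expR C * `|T y|.
Proof.
move=> /(_ y) /andP[h _]; rewrite -ler_pdivrMl ?expR_gt0 //.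
by rewrite -expRN.
Qed.

Lemma embP (Y Z : normedModType R) (C : R) (T : {linear Y -> Z}) :
  (forall y, `|T y| <= expR C * `|y|) -> (forall y, `|y| <= expR C * `|T y|) ->
  is_emb C T.
Proof.
move=> h1 h2 y; apply/andP; split=> //.
by rewrite expRN ler_pdivrMl ?expR_gt0.
Qed.

Lemma emb_comp (X Y Z : normedModType R) (C D : R) (T : {linear Y -> Z})
    (S : {linear X -> Y}) : is_emb C T -> is_emb D S -> is_emb (C + D) (T \o S).
Proof.
move=> hT hS; apply: embP => x; rewrite expRD -?mulrA /=.
  by rewrite (le_trans (emb_ub _ hT)) // ler_wpM2l ?expR_ge0 // emb_ub.
rewrite mulrCA (le_trans (emb_lb _ hS)) // ler_wpM2l ?expR_ge0 // emb_lb //.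
Qed.

Lemma emb0P (Y Z : normedModType R) (T : {linear Y -> Z}) :
  is_emb 0 T <-> forall y, `|T y| = `|y|.
Proof.
split=> h y; last by rewrite h oppr0 expR0 mul1r lexx.
by apply/eqP; rewrite eq_le; have := h y; rewrite oppr0 expR0 !mul1r andbC.
Qed.

Lemma emb_inj (Y Z : normedModType R) (C : R) (T : {linear Y -> Z}) :
  is_emb C T -> injective T.
Proof.
move=> h; apply: raddf_inj => y Ty; apply/eqP; rewrite -normr_le0.
by rewrite (le_trans (emb_lb y h)) // Ty normr0 mulr0.
Qed.

Lemma opnorm_le (Y Z : normedModType R) (f : Y -> Z) (c : R) :
  (forall y, `|f y| <= c * `|y|) -> 0 <= c -> opnorm f <= c.
Proof.
move=> h c0; apply: ge_sup.
  by exists `|f 0|; exists 0 => //=; rewrite normr0.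
move=> _ [y /= y1 <-]; rewrite (le_trans (h y)) // -[leRHS]mulr1.
by rewrite ler_wpM2l.
Qed.

Lemma opnorm_ge0 (Y Z : normedModType R) (f : Y -> Z) : 0 <= opnorm f.
Proof.
rewrite /opnorm; set S := (X in sup X).
have [[_ hS]|/sup_out -> //] := pselect (has_sup S).
apply: le_trans (normr_ge0 (f 0)) _; apply: ub_le_sup => //.
by exists 0 => //=; rewrite normr0.
Qed.

Lemma opnorm_ub (Y Z : normedModType R) (f : Y -> Z) (C : R) y :
  linear f -> (forall y, `|f y| <= C * `|y|) -> `|f y| <= opnorm f * `|y|.
Proof.
move=> lf h; pose T := mklin lf.
have [->|y0] := eqVneq y 0.
  by have := h 0; rewrite normr0 !mulr0.
have ny : 0 < `|y| by rewrite normr_gt0.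
rewrite -ler_pdivrMr // mulrC.
have -> : `|y|^-1 * `|f y| = `|f (`|y|^-1 *: y)|.
  by rewrite -[f (_ *: _)]/(T _) linearZ /= normrZ normfV normr_id.
apply: ub_le_sup; last first.
  by exists (`|y|^-1 *: y) => //=; rewrite normrZ normfV normr_id mulVf // gt_eqF.
exists `|C| => _ [z /= z1 <-]; rewrite (le_trans (h z)) //.
rewrite (le_trans (ler_wpM2r _ (ler_norm C))) //.
by rewrite -[leRHS]mulr1 ler_wpM2l.
Qed.

Lemma opnorm_fd (Y Z : normedModType R) (T : {linear Y -> Z}) y :
  finite_dim Y -> `|T y| <= opnorm T * `|y|.
Proof.
move=> /(fd_bounded T) [C _ h]; apply: opnorm_ub h; exact: linearP.
Qed.

(** An isomorphism [T] with [||T|| ||T^-1|| < e^e] becomes an embedding of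
    distortion at most [e] after division by [||T||], which can vanish only when
    [E] is the zero space. *)
Lemma dBM_emb (E F : fdNormed R) n e : has_dim E n -> has_dim F n ->
  dBM E F < e -> exists T : {linear E -> F}, is_emb e T.
Proof.
move=> /has_dim_iso [f [f' [ff' f'f]]] /has_dim_iso [g [g' [gg' g'g]]].
move=> /inf_lt [|r]; first set S := (X in X !=set0).
  exists (ln (opnorm (g' \o f) * opnorm (f' \o g))), (g' \o f), (f' \o g).
  split=> // x /=; first by rewrite g'g ff'.
  by rewrite f'f gg'.
move=> [T [U [TU UT rE]]] re.
have T_ub x := opnorm_fd T x (fd_finite_dim E).
have U_ub x := opnorm_fd U x (fd_finite_dim F).
set t := opnorm T in rE T_ub *; set u := opnorm U in rE U_ub *.
have [t0|tpos] := eqVneq t 0.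
  have E0 (x : E) : x = 0.
    have Tx : T x = 0.
      by apply/eqP; rewrite -normr_le0 -(mul0r `|x|) -t0.
    by rewrite -(TU x) Tx linear0.
  by exists T; apply: embP => y; rewrite (E0 y) linear0 !normr0 mulr0.
have tgt : 0 < t by rewrite lt_neqAle eq_sym tpos opnorm_ge0.
have ut (y : E) : `|y| <= u * t * `|y|.
  by rewrite -{1}(TU y) (le_trans (U_ub _)) // -mulrA ler_wpM2l ?opnorm_ge0.
have ut_e (y : E) : y != 0 -> 1 <= u * t <= expR e.
  move=> y0; have ut1 : 1 <= u * t.
    by have := ut y; rewrite -{1}[`|y|]mul1r ler_pM2r // normr_gt0.
  rewrite ut1 /= mulrC -[t * u]lnK; last by rewrite posrE mulrC (lt_le_trans _ ut1).
  by rewrite -rE ler_expR ltW.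
exists (t^-1 \*: T); apply: embP => y /=; have [->|y0] := eqVneq y 0.
- by rewrite linear0 scaler0 !normr0 mulr0.
- have /andP[ut1 ute] := ut_e y y0.
  rewrite normrZ gtr0_norm ?invr_gt0 // ler_pdivrMl // (le_trans (T_ub y)) //.
  by rewrite mulrCA -[leLHS]mul1r ler_wpM2r ?mulr_ge0 ?(le_trans ut1) // ltW.
- by rewrite linear0 scaler0 !normr0 mulr0.
- have /andP[ut1 ute] := ut_e y y0.
  rewrite normrZ gtr0_norm ?invr_gt0 //.
  rewrite -{1}(TU y) (le_trans (U_ub _)) //.
  by rewrite mulrA ler_wpM2r // ler_pdivlMr.
Qed.

(** [T] and its inverse have norm at most [expR e]. In dimension 0 both norms vanish,
    and the logarithm of 0 is 0, which is the infimum too. *)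
Lemma emb_dBM (E F : fdNormed R) (T : {linear E -> F}) e :
  0 <= e -> is_emb e T -> (forall z, exists y, T y = z) -> dBM E F <= e + e.
Proof.
move=> e0 hT Tsurj; have [S TS] := fd_section (fd_finite_dim F) Tsurj.
have ST : cancel T S by move=> y; apply: (emb_inj hT); rewrite TS.
apply: (@le_trans _ _ (ln (opnorm T * opnorm S))).
  apply: ge_inf; last by exists T, S.
  exists 0 => _ [U [V [UV VU ->]]].
  have U_ub x := opnorm_fd U x (fd_finite_dim E).
  have V_ub x := opnorm_fd V x (fd_finite_dim F).
  have [[y y0]|E0] := pselect (exists y : E, y != 0).
    apply: ln_ge0; have : `|y| <= opnorm U * opnorm V * `|y|.
      rewrite -{1}(UV y) (le_trans (V_ub _)) //.
      by rewrite [opnorm U * _]mulrC -mulrA ler_wpM2l ?opnorm_ge0.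
    by rewrite -{1}[`|y|]mul1r ler_pM2r // normr_gt0.
  rewrite (_ : opnorm U = 0) ?mul0r ?ln0 //.
  apply/eqP; rewrite eq_le opnorm_ge0 andbT; apply: opnorm_le => // y.
  have -> : y = 0 by apply/eqP/negPn/negP => y0; apply: E0; exists y.
  by rewrite linear0 normr0 mul0r.
have t_le : opnorm T <= expR e.
  by apply: opnorm_le (expR_ge0 _) => y; exact: emb_ub.
have s_le : opnorm S <= expR e.
  by apply: opnorm_le (expR_ge0 _) => y; rewrite -{2}(TS y) emb_lb.
have ts_le : opnorm T * opnorm S <= expR (e + e).
  by rewrite expRD ler_pM ?opnorm_ge0.
have [ts0|ts0] := leP (opnorm T * opnorm S) 0; first by rewrite ln0 // addr_ge0.
by rewrite -[e + e]expRK ler_ln ?posrE ?expR_gt0.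
Qed.

End Operators.

Section Ages.
Context {R : realType}.

Lemma fds_incl_linear (X : normedModType R) (V : linSubspace X) :
  linear (fun x : subspace_type V => (sval x : X)).
Proof. by move=> a x y. Qed.

Definition fds_inj (X : normedModType R) (V : fdSubspace X) : {linear fds_space V -> X} :=
  mklin (@fds_incl_linear X V).

Lemma fds_incl_emb (X : normedModType R) (V : fdSubspace X) : is_emb 0 (fds_inj V).
Proof. exact/emb0P. Qed.

Lemma image_subspace (E : fdNormed R) (X : normedModType R) (T : {linear E -> X}) :
  exists (V : fdSubspace X) (S : {linear E -> fds_space V}),
    (forall y, fds_inj V (S y) = T y) /\ (forall v, exists y, S y = v).
Proof.
pose P := [pred x : X | `[< exists y, T y = x >]].
have cP : submod_closed P.
  split; first by apply/asboolP; exists 0; rewrite linear0.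
  move=> a _ _ /asboolP [x <-] /asboolP [y <-]; apply/asboolP.
  by exists (a *: x + y); rewrite linearP.
pose V := LinSubspace cP.
have TV y : T y \in P by apply/asboolP; exists y.
pose s y : subspace_type V := exist _ (T y) (TV y).
have ls : linear s by move=> a x y; apply: val_inj; rewrite /= linearP.
have s_surj v : exists y, s y = v.
  by case: v => v Pv; have /asboolP [y yv] := Pv; exists y; apply: val_inj.
have Vfd : finite_dim (subspace_type V : normedModType R).
  exact: (@fd_linear_image _ E (subspace_type V) (mklin ls) (fd_finite_dim E)).
by exists (FdSubspace Vfd), (mklin ls).
Qed.

Lemma has_dim_trans (V W : normedModType R) n (T : {linear V -> W}) :
  bijective T -> has_dim W n -> has_dim V n.
Proof. by move=> Tb [f fb]; exists (f \o T); exact: bij_comp. Qed.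

Lemma image_dBM (E : fdNormed R) (X : normedModType R) (T : {linear E -> X}) e :
  0 <= e -> is_emb e T -> exists (V : fdSubspace X) n,
    [/\ has_dim E n, has_dim (fds_space V) n & dBM E (fds_space V) <= e + e].
Proof.
move=> e0 hT; have [V [S [VS Ssurj]]] := image_subspace T.
have hS : is_emb e S by move=> y; have := hT y; rewrite -VS.
have [n hn] := fd_finite_dim (fds_space V).
exists V, n; split=> //; last exact: emb_dBM.
apply: has_dim_trans hn.
have [S' SS'] := fd_section (fd_finite_dim (fds_space V)) Ssurj.
by exists S' => // y; apply: (emb_inj hS); rewrite SS'.
Qed.

Lemma isometric_refl (X : normedModType R) : isometric X X.
Proof. by exists idfun; split=> // z; exists z. Qed.

(** The Banach-Mazur distance compares spaces of equal dimension. This criterion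
    frees the closed age of dimensions and of the metric. *)
Lemma age_clP (X : normedModType R) E :
  age_cl X E <-> forall e, 0 < e -> exists T : {linear E -> X}, is_emb e T.
Proof.
split=> [h e e0|h e e0].
  have [F [n [[V [U [Uiso _]]] dE dF /(dBM_emb dE dF) [T hT]]]] := h e e0.
  exists (fds_inj V \o (U \o T)).
  rewrite -[e]add0r; apply: emb_comp (@fds_incl_emb _ _) _.
  by rewrite -[e]add0r; apply: emb_comp hT; exact/emb0P.
have e3 : 0 < e / 3 by rewrite divr_gt0.
have [T hT] := h _ e3.
have [V [n [dE dV dEV]]] := image_dBM (ltW e3) hT.
exists (fds_space V), n; split=> //; last by rewrite (le_lt_trans dEV) //; lra.
by exists V; exact: isometric_refl.
Qed.

(** The image of an almost isometric embedding of [E] into a member of [K] is a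
    member of [K] by heredity, and is close to [E]. *)
Lemma class_emb (K : fdNormed R -> Prop) (E : fdNormed R) : HP K ->
  (forall F, bm_closure K F -> K F) ->
  (forall e, 0 < e -> exists (F : fdNormed R) (T : {linear E -> F}), K F /\ is_emb e T) -> K E.
Proof.
move=> hp cl h; apply: cl => e e0.
have e3 : 0 < e / 3 by rewrite divr_gt0.
have [F [T [KF hT]]] := h _ e3.
have [V [n [dE dV dEV]]] := image_dBM (ltW e3) hT.
exists (fds_space V), n; split=> //; last by rewrite (le_lt_trans dEV) //; lra.
by apply: hp KF _; exists (fds_inj V); exact: fds_incl_emb.
Qed.

End Ages.

(** * Ultralimits of seminorms and uniformity on finite-dimensional spaces *)

Section Ultralimits.
Context {R : realType}.

Lemma bounded_ultra_cvg (U : set_system nat) (u : nat -> R) (B : R) :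
  UltraFilter U -> (forall n, `|u n| <= B) -> exists l : R, u n @[n --> U] --> l.
Proof.
move=> UU hB; have hU : UltraFilter (u @ U).
  constructor; first exact: fmap_proper_filter.
  move=> G GF sG; rewrite eqEsubset; split=> // A GA.
  have [//|UA] := in_ultra_setVsetC (u @^-1` A) UU.
  exfalso; apply: (@filter_not_empty _ G GF); rewrite -(setICr A).
  exact: filterI GA (sG (~` A) UA).
have := @segment_compact R (- B) B.
rewrite compact_ultra => /(_ _ hU) [|l [_ hl]]; last by exists l.
rewrite /= /nbhs /=; apply: (@filterE _ U) => n.
by rewrite /= in_itv /= -ler_norml hB.
Qed.

(** An ultrafilter replaces the extraction of convergent subsequences: all the
    values converge along it simultaneously, so that the limit is a seminorm. *)
Lemma seminorm_ultralimit (U : set_system nat) (W : lmodType R)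
    (N : nat -> seminorm W) : UltraFilter U ->
  (forall w, exists B, forall n, N n w <= B) ->
  exists L : seminorm W, forall w, N n w @[n --> U] --> L w.
Proof.
move=> UU hB; have hL w : exists l : R, N n w @[n --> U] --> l.
  have [B hBw] := hB w; apply: (@bounded_ultra_cvg _ _ B) => n.
  by rewrite ger0_norm ?sn_ge0.
pose L w := projT1 (cid (hL w)).
have cL w : N n w @[n --> U] --> L w by rewrite /L; case: cid.
have LD x y : L (x + y) <= L x + L y.
  apply: (@ler_cvg_to _ U _ _ (fun n => N n (x + y)) (fun n => N n x + N n y)) => //.
    exact: cvgD.
  by apply: nearW => n; exact: snD.
have LZ a x : L (a *: x) = `|a| * L x.
  have c1 : N n (a *: x) @[n --> U] --> `|a| * L x.
    have -> : (fun n => N n (a *: x)) = (fun n => N n x * `|a|).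
      by apply/funext => n; rewrite snZ mulrC.
    by rewrite mulrC; exact: cvgMr_tmp.
  exact: (@cvg_unique _ (@Rhausdorff R) _ _ _ _ (cL _) c1).
by exists (Seminorm LD LZ).
Qed.

Lemma free_ultrafilter : exists U : set_system nat, UltraFilter U /\ \oo `<=` U.
Proof. exact: ultraFilterLemma. Qed.

(** Integer vectors with entries between [-r] and [r], indexed by a finite type so
    that finitely many conditions control a seminorm. *)
Definition grid_row n r (g : {ffun 'I_n -> 'I_r.*2.+1}) : 'rV[R]_n :=
  \row_i ((g i)%:R - r%:R).

Lemma grid_approx n r (v : 'rV[R]_n) : `|v| <= 1 ->
  exists g : {ffun 'I_n -> 'I_r.*2.+1}, `|r%:R *: v - grid_row g| <= 1.
Proof.
move=> v1; pose t i := r%:R * v 0 i + r%:R.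
have tP i : 0 <= t i <= r.*2%:R.
  have : `|v 0 i| <= 1 by apply: le_trans v1; exact: row_coord_le.
  rewrite ler_norml => /andP[h1 h2]; rewrite /t -muln2 natrM.
  have r0 : 0 <= r%:R :> R by [].
  by apply/andP; split; nra.
have tN i : (Num.truncn (t i) < r.*2.+1)%N.
  rewrite ltnS -(ler_nat R); have /andP[t0 t2] := tP i.
  by apply: le_trans t2; rewrite truncn_le.
exists [ffun i => Ordinal (tN i)]; apply: row_norm_le => // i.
rewrite !mxE ffunE /=; have /andP[t0 t2] := tP i.
have := truncn_itv t0; set k := Num.truncn _; rewrite /t -natr1 => /andP[h1 h2].
by rewrite ler_norml; apply/andP; split; lra.
Qed.

(** By homogeneity it is enough to compare [N] and [N'] on vectors of norm [r], and
    these lie at distance at most 1 from the grid; so the error of order [k + 2 M]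
    is divided by [r]. *)
Lemma grid_close n r (N N' : seminorm 'rV[R]_n) (M k : R) : (0 < r)%N ->
  (forall v, N v <= M * `|v|) -> (forall v, N' v <= M * `|v|) ->
  (forall g : {ffun 'I_n -> 'I_r.*2.+1}, `|N (grid_row g) - N' (grid_row g)| <= k) ->
  forall v, `|N v - N' v| <= (k + 2 * M) / r%:R * `|v|.
Proof.
move=> r0 hN hN' hg v; have [->|v0] := eqVneq v 0.
  by rewrite !sn0 subrr !normr0 mulr0.
have nv : 0 < `|v| by rewrite normr_gt0.
have rR : 0 < r%:R :> R by rewrite ltr0n.
have M0 : 0 <= M by rewrite -(pmulr_lge0 _ nv) (le_trans (sn_ge0 N v)).
pose u := `|v|^-1 *: v; have u1 : `|u| = 1 by rewrite normrZ normfV normr_id mulVf // gt_eqF.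
have [g ug] : exists g : {ffun 'I_n -> 'I_r.*2.+1}, `|r%:R *: u - grid_row g| <= 1.
  by apply: grid_approx; rewrite u1.
have close (P : seminorm 'rV[R]_n) : (forall v, P v <= M * `|v|) ->
    `|r%:R * P u - P (grid_row g)| <= M.
  move=> hP; have -> : r%:R * P u = P (r%:R *: u) by rewrite (snZ P r%:R u) ger0_norm.
  apply: le_trans (sn_dist _ _ _) _; apply: le_trans (hP _) _.
  by rewrite -[leRHS]mulr1 ler_wpM2l.
have main : `|r%:R * (N u - N' u)| <= k + 2 * M.
  have := close N hN; have := close N' hN'; have := hg g.
  by rewrite !ler_norml => h1 h2 h3; lra.
have Nv (P : seminorm 'rV[R]_n) : P v = `|v| * P u.
  by rewrite (snZ P (`|v|^-1) v) normfV normr_id mulVKf ?gt_eqF.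
rewrite !Nv -mulrBr normrM normr_id [leRHS]mulrC ler_wpM2l // ler_pdivlMr //.
by rewrite mulrC -(ger0_norm (ltW rR)) -normrM.
Qed.

Lemma near_isometry_emb (Y Z : normedModType R) (T : {linear Y -> Z}) e :
  (forall y, `| `|T y| - `|y| | <= (1 - expR (- e)) * `|y|) -> is_emb e T.
Proof.
move=> h y; have := h y; rewrite ler_norml => /andP[h1 h2].
apply/andP; split; first lra.
(* x + 1 / x >= 2 for x = expR e *)
have : 2 - expR (- e) <= expR e.
  rewrite expRN; set x := expR e; have x0 : 0 < x by apply: expR_gt0.
  rewrite -(ler_pM2r x0) mulrBl mulVf ?gt_eqF //.
  by have := sqr_ge0 (x - 1); rewrite sqrrB expr2 mulr1 expr1n; lra.
move=> h3; apply: (@le_trans _ _ ((2 - expR (- e)) * `|y|)); first lra.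
by rewrite ler_wpM2r.
Qed.

Lemma one_sub_expRN_gt0 (e : R) : 0 < e -> 0 < 1 - expR (- e).
Proof. by move=> e0; rewrite subr_gt0 -expR0 ltr_expR oppr_lt0. Qed.

(** Pointwise convergence of the norms makes them uniformly bounded on a basis,
    hence equicontinuous; convergence on a finite grid is then enough. *)
Lemma pointwise_emb (L X : normedModType R) (T : nat -> {linear L -> X})
    (F : set_system nat) (e : R) : finite_dim L -> ProperFilter F ->
  (forall x, `|T n x| @[n --> F] --> `|x|) -> 0 < e ->
  \forall n \near F, is_emb e (T n).
Proof.
move=> /fd_param [d [s [s' s's ss']]] FF hT e0.
have [c c0 hc] := injective_row_below (can_inj s's).
set k := 1 - expR (- e); have k0 : 0 < k by exact: one_sub_expRN_gt0.
pose M := \sum_i (`|s (delta_mx 0 i)| + 1).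
pose r := (Num.truncn ((1 + 2 * M) / (k * c))).+1.
have rP : (1 + 2 * M) / r%:R <= k * c.
  rewrite ler_pdivrMr ?ltr0n // -ler_pdivrMl ?mulr_gt0 // mulrC.
  by apply: ltW; exact: truncnS_gt.
near=> n; apply: near_isometry_emb => y; rewrite -/k.
rewrite -{2 3}(ss' y); set v := s' y.
have -> : `|T n y| = lin_seminorm (T n \o s) v by rewrite lin_seminormE /= ss'.
rewrite -[`|s v|]/(lin_seminorm s v).
have hM w : lin_seminorm (T n \o s) w <= M * `|w|.
  apply: le_trans (seminorm_row_bounded _ _) _; rewrite ler_wpM2r //.
  apply: ler_sum => i _; rewrite lin_seminormE /=.
  have : forall i, `|T n (s (delta_mx 0 i))| <= `|s (delta_mx 0 i)| + 1.
    near: n; apply: filter_forall => j.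
    by apply: cvgr_le; [exact: hT|rewrite ltrDl].
  exact.
have hM' w : lin_seminorm s w <= M * `|w|.
  apply: le_trans (seminorm_row_bounded _ _) _; rewrite ler_wpM2r //.
  by apply: ler_sum => i _; rewrite lerDl.
apply: le_trans (@grid_close d r _ _ M 1 _ hM hM' _ v) _ => //.
  near: n; apply: filter_forall => g.
  have hg := hT (s (grid_row g)).
  move/cvgrPdist_le: hg => /(_ 1 ltr01).
  by apply: filterS => n /=; rewrite distrC.
apply: (@le_trans _ _ (k * c * `|v|)); first by rewrite ler_wpM2r.
by rewrite -mulrA ler_wpM2l // ltW.
Unshelve. all: by end_near. Qed.

End Ultralimits.

(** * Amalgamation inside a space, and guards *)

Section Amalgamation.
Context {R : realType}.

Lemma le_expR_eps (x y : R) : 0 <= y ->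
  (forall e, 0 < e -> x <= expR e * y) -> x <= y.
Proof.
move=> y0 h; rewrite leNgt; apply/negP => yx.
have [y00|yn0] := eqVneq y 0.
  by have := h 1 ltr01; rewrite y00 mulr0 leNgt -y00 yx.
have yp : 0 < y by rewrite lt_neqAle eq_sym yn0.
have xy1 : 1 < x / y by rewrite ltr_pdivlMr // mul1r.
have l0 : 0 < ln (x / y) by rewrite ln_gt0.
have := h (ln (x / y) / 2) (divr_gt0 l0 _); rewrite ltr0n => /(_ isT).
rewrite leNgt -ltr_pdivlMr // => /negP; apply.
rewrite -[ltRHS]lnK; last by rewrite posrE divr_gt0 // (lt_trans yp).
by rewrite ltr_expR; lra.
Qed.

Lemma expR_le2 (x : R) : x <= 1 / 2 -> expR x <= 2.
Proof.
move=> hx; rewrite -[x]opprK expRN -[leRHS]invrK lef_pV2 ?posrE ?expR_gt0 //.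
by have := expR_ge1Dx (- x); lra.
Qed.

Lemma fd_prod (G H : fdNormed R) : finite_dim (G * H)%type.
Proof.
have [m [s [s' _ ss']]] := fd_param (fd_finite_dim G).
have [n [t [t' _ tt']]] := fd_param (fd_finite_dim H).
pose f (v : 'rV[R]_(m + n)) : (G * H)%type := (s (lsubmx v), t (rsubmx v)).
have lf : linear f by move=> a u v; rewrite /f !linearP.
apply: (@fd_of_surj _ _ _ (mklin lf)) => -[g h].
by exists (row_mx (s' g) (t' h)); rewrite /= /f row_mxKl row_mxKr ss' tt'.
Qed.

(** The amalgam is [G * H] with the limit of the seminorms [`|i_n g + j_n h|] along
    an ultrafilter, divided by its kernel. The factors embed exactly
    isometrically, since the distortion of [i_n] and [j_n] tends to 0. The
    quotient lies in the closed age: composed with a linear section of the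
    quotient map, the maps into [X] are asymptotically isometric pointwise, hence
    uniformly. *)
Lemma ultra_amalgam (X : normedModType R) (E G H : fdNormed R)
    (a : {linear E -> G}) (b : {linear E -> H}) (c : R) :
  (forall eta, 0 < eta -> exists (i : {linear G -> X}) (j : {linear H -> X}),
     [/\ is_emb eta i, is_emb eta j & forall e, `|i (a e) - j (b e)| <= c * `|e|]) ->
  exists (L : fdNormed R) (i : {linear G -> L}) (j : {linear H -> L}),
    [/\ age_cl X L, is_emb 0 i, is_emb 0 j &
        forall e, `|i (a e) - j (b e)| <= c * `|e|].
Proof.
move=> h; have h' n : exists ij : {linear G -> X} * {linear H -> X},
    [/\ is_emb n.+1%:R^-1 ij.1, is_emb n.+1%:R^-1 ij.2
      & forall e, `|ij.1 (a e) - ij.2 (b e)| <= c * `|e|].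
  by have [|i [j ?]] := h n.+1%:R^-1; [rewrite invr_gt0|exists (i, j)].
pose ij n := projT1 (cid (h' n)).
have ijP n : [/\ is_emb n.+1%:R^-1 (ij n).1, is_emb n.+1%:R^-1 (ij n).2
      & forall e, `|(ij n).1 (a e) - (ij n).2 (b e)| <= c * `|e|].
  by rewrite /ij; case: cid.
pose u n (p : (G * H)%type) := (ij n).1 p.1 + (ij n).2 p.2.
have lu n : linear (u n).
  by move=> r p q; rewrite /u /= !linearP scalerDr addrACA.
have [U [UU sU]] := free_ultrafilter.
pose N n := lin_seminorm (mklin (lu n)).
have [n|L hL] := seminorm_ultralimit (N := N) UU.
  exists (expR 1 * `|n.1| + expR 1 * `|n.2|) => k.
  have [h1 h2 _] := ijP k; have k1 : k.+1%:R^-1 <= 1 :> R.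
    by rewrite invf_le1 // ler1n.
  rewrite /N lin_seminormE (le_trans (ler_normD _ _)) // lerD //.
    exact: emb_ub (emb_le k1 h1).
  exact: emb_ub (emb_le k1 h2).
have Lfd : finite_dim (squot L : normedModType R).
  exact: (fd_linear_image (p := sproj L)) (fd_prod G H) (@sproj_surj _ _ L).
have near_inv (e : R) : 0 < e -> \forall n \near U, n.+1%:R^-1 <= e.
  move=> e0; apply: sU; near=> n; apply: ltW; near: n.
  exact: near_infty_natSinv_lt (PosNum e0).
have Liso (Z : normedModType R) (t : {linear Z -> (G * H)%type}) :
    (forall n, is_emb n.+1%:R^-1 (mklin (lu n) \o t)) ->
    is_emb 0 (sproj L \o t).
  move=> ht; apply/emb0P => z; rewrite /= norm_sproj.
  apply/eqP; rewrite eq_le; apply/andP; split.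
    apply: le_expR_eps => // e e0.
    apply: cvgr_to_le (hL (t z)) _.
    apply: filterS (near_inv e e0) => n ne.
    exact: emb_ub (emb_le ne (ht n)).
  apply: le_expR_eps => [|e e0]; first exact: sn_ge0.
  rewrite -ler_pdivrMl ?expR_gt0 //.
  apply: cvgr_to_ge (hL (t z)) _.
  apply: filterS (near_inv e e0) => n ne.
  rewrite ler_pdivrMl ?expR_gt0 //.
  exact: emb_lb (emb_le ne (ht n)).
have linl : linear (fun g : G => (g, 0) : (G * H)%type).
  by move=> r x y; congr (_, _); rewrite /= scaler0 addr0.
have linr : linear (fun y : H => (0, y) : (G * H)%type).
  by move=> r x y; congr (_, _); rewrite /= scaler0 addr0.
exists (FdNormed Lfd), (sproj L \o mklin linl), (sproj L \o mklin linr); split.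
- apply/age_clP => e e0.
  (* the maps u_n do not factor through the quotient, but their composites with a
     section do as well *)
  have [t ht] := fd_section (p := sproj L) Lfd (@sproj_surj _ _ L).
  have hT x : `|(mklin (lu n) \o t) x| @[n --> U] --> `|x|.
    by rewrite -{2}[x]ht norm_sproj; exact: hL.
  have := pointwise_emb (T := fun n => mklin (lu n) \o t) Lfd (@ultra_proper _ _ UU) hT e0.
  by move=> /filter_ex [n hn]; exists (mklin (lu n) \o t).
- apply: Liso => n x; have [h1 _ _] := ijP n.
  by rewrite /= /u /= linear0 addr0.
- apply: Liso => n x; have [_ h2 _] := ijP n.
  by rewrite /= /u /= linear0 add0r.
- move=> e; rewrite /= -linearB norm_sproj.
  apply: cvgr_to_le (hL _) _; apply: nearW => n.
  have [_ _ h3] := ijP n.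
  by rewrite /N lin_seminormE /= /u /= subr0 sub0r linearN; exact: h3.
Unshelve. all: by end_near. Qed.

Definition lin0 (V W : lmodType R) : {linear V -> W} := \0.

Lemma lin0E (V W : lmodType R) (x : V) : lin0 V W x = 0.
Proof. by []. Qed.

(** The space [F] given by (gF-1) serves as a guard: for [psi] from [F] to [G], embed
    [G] in [X] almost isometrically in any way; an isometry of [X] moves its
    composite with [psi] next to the inclusion, on [E]. *)
Lemma gF1_gF2 (X : normedModType R) : gF1 X -> gF2 X.
Proof.
move=> h E eps e0; have [d [F [EF [d0 hF]]]] := h E eps e0.
pose phi (x : fds_space E) : fds_space F := exist _ (sval x) (EF _ (svalP x)).
have lphi : linear phi by move=> a x y; apply: val_inj.
have d2 : 0 < d / 2 by rewrite divr_gt0.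
exists (fds_space F), (mklin lphi), (d / 2); split=> //.
- apply/age_clP => e e1; exists (fds_inj F).
  by apply: emb_le (@fds_incl_emb _ _ _); exact: ltW.
- by apply: (@emb_le _ _ _ 0); [exact: ltW|exact/emb0P].
move=> G psi eta /age_clP KG hpsi eta0.
have [|i0 hi0] := KG (Num.min eta (d / 2)); first by rewrite lt_min eta0.
have [] := hF (i0 \o psi) (fds_inj F).
- have := emb_comp (emb_le _ hi0) hpsi; move=> /(_ (d / 2)); rewrite ge_min lexx orbT.
  by move=> /(_ isT); rewrite -splitr.
- by apply: emb_le (@fds_incl_emb _ _ _); exact: ltW.
move=> T [[Tiso _] hT]; exists (T \o i0); split=> //.
rewrite -[eta]add0r; apply: emb_comp; first exact/emb0P.
by apply: emb_le hi0; rewrite ge_min lexx.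
Qed.

(** The second half of (gF-2) for a space that sits in [X] through a map [a], so that
    abstract spaces can be used instead of subspaces; the bound on the operator
    norm becomes a bound at each vector. *)
Definition guard (X : normedModType R) (A : fdNormed R) (a : {linear A -> X})
    (F : fdNormed R) (phi : {linear A -> F}) (delta c : R) : Prop :=
  forall (G : fdNormed R) (psi : {linear F -> G}) (eta : R),
    age_cl X G -> is_emb delta psi -> 0 < eta ->
    exists2 iota : {linear G -> X}, is_emb eta iota &
      forall x, `|a x - iota (psi (phi x))| <= c * `|x|.

(** The guard of the image of [a], precomposed with [a]; the image need not be
    isometric to [A], whence the distortion [C]. *)
Lemma gF2_guard (X : normedModType R) (A : fdNormed R) (a : {linear A -> X}) (C eps : R) :
  gF2 X -> is_emb C a -> 0 < eps ->
  exists (F : fdNormed R) (phi : {linear A -> F}) (delta : R),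
    [/\ age_cl X F, is_emb (eps + C) phi, 0 < delta & guard a phi delta (eps * expR C)].
Proof.
move=> gX ha e0; have [V [S [VS _]]] := image_subspace a.
have hS : is_emb C S by move=> x; have := ha x; rewrite -VS.
have [F [phi [d [KF hphi d0 hG]]]] := gX V eps e0.
exists F, (phi \o S), d; split=> //; first exact: emb_comp.
move=> G psi eta KG hpsi eta0; have [i [hi]] := hG G psi eta KG hpsi eta0.
set f := (X in opnorm X) => hf; exists i => // x.
have lf : linear f := linearP (fds_inj V \- (i \o (psi \o phi))).
have fb y : `|f y| <= (1 + expR (eta + (d + eps))) * `|y|.
  apply: le_trans (ler_normB _ _) _; rewrite mulrDl mul1r lerD //.
  exact: (emb_ub y (emb_comp hi (emb_comp hpsi hphi))).
have := opnorm_ub (S x) lf fb; rewrite -VS /= => /le_trans; apply.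
apply: le_trans (_ : eps * `|S x| <= _); first by rewrite ler_wpM2r // ltW.
by rewrite -mulrA ler_wpM2l ?emb_ub // ltW.
Qed.

End Amalgamation.

(** * The closed age of a guarded Fraisse space is a guarded Fraisse class *)

Section ClassOfASpace.
Context {R : realType}.

Lemma age_cl_emb (X : normedModType R) (E : fdNormed R) : age_cl X E <->
  forall e, 0 < e -> exists F : fdNormed R,
    age_cl X F /\ exists T : {linear E -> F}, is_emb e T.
Proof.
split=> [KE e e0|h].
  by exists E; split=> //; exists idfun; apply: (emb_le (ltW e0)); exact/emb0P.
apply/age_clP => e e0; have e2 : 0 < e / 2 by rewrite divr_gt0.
have [F [/age_clP/(_ _ e2) [S hS] [T hT]]] := h _ e2.
by exists (S \o T); rewrite [e]splitr; exact: emb_comp.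
Qed.

Lemma isometric_inv (Y : normedModType R) (E : fdNormed R) :
  isometric Y E -> exists T : {linear E -> Y}, is_surj_isometry T.
Proof.
move=> [T [Tiso Tsurj]]; have [S TS] := fd_section (fd_finite_dim E) Tsurj.
exists S; split=> [y|z]; first by rewrite -Tiso TS.
exists (T z); apply: (@emb_inj _ _ _ 0 T); first exact/emb0P.
by rewrite TS.
Qed.

Lemma age_cl_bm_set (X : normedModType R) : bm_set (age_cl X).
Proof.
move=> E F /isometric_inv [T [Tiso _]] KE; apply/age_cl_emb => e e0.
exists E; split=> //; exists T; apply: (emb_le (ltW e0)); exact/emb0P.
Qed.

Lemma age_cl_HP (X : normedModType R) : HP (age_cl X).
Proof.
move=> E F KF [T hT]; apply/age_cl_emb => e e0.
by exists F; split=> //; exists T; exact: emb_le (ltW e0) hT.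
Qed.

Lemma age_cl_closed (X : normedModType R) E : bm_closure (age_cl X) E -> age_cl X E.
Proof.
move=> h; apply/age_cl_emb => e /h [F [n [KF dE dF lt]]].
by exists F; split=> //; exact: (dBM_emb dE dF lt).
Qed.

(** Two members of the closed age embed almost isometrically in [X]; amalgamate over
    the zero map. *)
Lemma age_cl_JEP (X : normedModType R) : JEP (age_cl X).
Proof.
move=> F G /age_clP KF /age_clP KG.
have [eta /[dup] /KF [i hi] /KG [j hj]|L [i [j [KL hi hj _]]]] :=
  @ultra_amalgam R X F F G (lin0 _ _) (lin0 _ _) 0.
  by exists i, j; split=> // e; rewrite !lin0E !raddf0 addr0 normr0 mul0r.
by exists L; split=> //; [exists i | exists j].
Qed.

(** Both [G] and [H] are sent almost isometrically to [X] by the guard, in such a way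
    that [E] is nearly fixed; hence the two images of [E] are close to one another,
    and the ultralimit of these pairs of maps is the amalgam. *)
Lemma gF2_GAP (X : normedModType R) : gF2 X -> GAP (age_cl X).
Proof.
move=> gX E eps /age_clP KE eps0.
(* the two images of E are within 2 e exp(e) <= 4 e < eps of one another *)
pose e := Num.min eps 1 / 8.
have e0 : 0 < e by rewrite divr_gt0 // lt_min eps0 /=.
have e_eps : 8 * e <= eps by rewrite /e mulrC divfK // ge_min lexx.
have e_1 : 8 * e <= 1 by rewrite /e mulrC divfK // ge_min lexx orbT.
have [a ha] := KE e e0.
have [F [phi [d [KF hphi d0 hG]]]] := gF2_guard gX ha e0.
exists F, phi, d; split=> //; first by apply: emb_le hphi; lra.
move=> G H psiG psiH KG KH hG' hH'.
have [eta eta0|L [i [j [KL hi hj hij]]]] :=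
  @ultra_amalgam R X E G H (psiG \o phi) (psiH \o phi) (4 * e).
  have [i hi hie] := hG G psiG eta KG hG' eta0.
  have [j hj hje] := hG H psiH eta KH hH' eta0.
  exists i, j; split=> // x /=.
  have -> : i (psiG (phi x)) - j (psiH (phi x)) =
      (a x - j (psiH (phi x))) - (a x - i (psiG (phi x))).
    by rewrite opprB [RHS]addrC addrA subrK.
  rewrite (le_trans (ler_normB _ _)) // (le_trans (lerD (hje x) (hie x))) //.
  rewrite -mulrDl ler_wpM2r //.
  have := @expR_le2 _ e; have -> : e <= 1 / 2 by lra.
  by move=> /(_ isT) ?; nra.
exists L, i, j; split=> //; apply: (@le_lt_trans _ _ (4 * e)); last by lra.
by apply: opnorm_le => //; rewrite mulr_ge0 // ltW.
Qed.

Lemma gF2_class (X : normedModType R) : gF2 X -> guarded_fraisse_class (age_cl X).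
Proof.
move=> gX; split.
- exact: age_cl_bm_set.
- exists (FdNormed (@fd_row R 0)); apply/age_clP => e e0.
  exists (lin0 _ _) => y /=; have -> : y = 0 by apply/rowP => -[].
  by rewrite !normr0 !mulr0 lexx.
- exact: age_cl_closed.
- exact: age_cl_HP.
- exact: age_cl_JEP.
- exact: gF2_GAP.
Qed.

Lemma isometric_age_cl (X Y : normedModType R) : isometric X Y -> age_cl X = age_cl Y.
Proof.
move=> [T [Tiso Tsurj]]; apply/funext => E; apply/propext; rewrite !age_clP.
split=> h e e0; have [S hS] := h e e0.
  exists (T \o S); rewrite -[e]add0r; apply: emb_comp => //; exact/emb0P.
pose U y := projT1 (cid (Tsurj y)).
have TU y : T (U y) = y by rewrite /U; case: cid.
have Tinj : injective T by apply: (@emb_inj _ _ _ 0); exact/emb0P.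
have lU : linear U by move=> r y z; apply: Tinj; rewrite TU linearP !TU.
exists (mklin lU \o S); rewrite -[e]add0r; apply: emb_comp => //; apply/emb0P => y.
by rewrite -Tiso /= TU.
Qed.

End ClassOfASpace.

(** * Towers of finite-dimensional spaces: uniqueness of the limit *)

Section Towers.
Context {R : realType}.

Definition geo (n : nat) : R := 2^-1 ^+ n.

Lemma geo_gt0 n : 0 < geo n.
Proof. by rewrite exprn_gt0. Qed.

Lemma geoS n : geo n.+1 = geo n / 2.
Proof. by rewrite /geo exprSr. Qed.

Lemma geo_decr n m : (n <= m)%N -> geo m <= geo n.
Proof.
elim: m => [|m IH]; first by rewrite leqn0 => /eqP ->.
rewrite leq_eqVlt => /predU1P [-> //|]; rewrite ltnS => /IH h.
by rewrite geoS; have := geo_gt0 m; lra.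
Qed.

Lemma geo_le1 n : geo n <= 1.
Proof. by have := geo_decr (leq0n n); rewrite {2}/geo expr0. Qed.

Lemma geo_small e : 0 < e -> exists N, forall n, (N <= n)%N -> geo n <= e.
Proof.
move=> e0; have : (fun n => geo n) @ \oo --> (0 : R).
  by apply: cvg_expr; rewrite ger0_norm // invf_lt1 // ltr1n.
move=> /cvgrPdist_le /(_ e e0) [N _ hN]; exists N => n /hN /=.
by rewrite sub0r normrN ger0_norm // ltW // geo_gt0.
Qed.

Variables (L : nat -> fdNormed R) (p : forall n, {linear L n -> L n.+1}).

Definition tcast n m : L n -> L m :=
  if @eqP _ n m is ReflectT e then fun z => ecast k (L k) e z else fun=> 0.

Lemma tcast_id n z : @tcast n n z = z.
Proof. by rewrite /tcast; case: eqP => // e; rewrite (eq_irrelevance e (erefl n)). Qed.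

Lemma tcast_neq n m z : n != m -> @tcast n m z = 0.
Proof. by rewrite /tcast; case: eqP. Qed.

Lemma tcast_linear n m : linear (@tcast n m).
Proof.
have [<-|nm] := eqVneq n m; first by move=> a x y; rewrite !tcast_id.
by move=> a x y; rewrite !tcast_neq // scaler0 addr0.
Qed.

(** The composite of the maps [p k] for [n <= k < m], and 0 when [m < n]. Being
    defined for all pairs of indices, it needs a cast only along [n = m]. *)
Fixpoint tmap n m : L n -> L m :=
  match m with
  | 0 => @tcast n 0
  | k.+1 => fun z => @tcast n k.+1 z + p k (@tmap n k z)
  end.

Lemma tmap_linear n m : linear (@tmap n m).
Proof.
elim: m => [|m IH]; first exact: tcast_linear.
move=> a x y; rewrite /= IH tcast_linear linearP scalerDr.
by rewrite addrACA.
Qed.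

Lemma tmap_lt n m z : (m < n)%N -> @tmap n m z = 0.
Proof.
elim: m => [|m IH] mn /=; first by rewrite tcast_neq // gtn_eqF.
by rewrite tcast_neq ?gtn_eqF // add0r IH ?linear0 // ltnW.
Qed.

Lemma tmap_id n z : @tmap n n z = z.
Proof.
case: n z => [|n] z /=; first exact: tcast_id.
by rewrite tcast_id tmap_lt // linear0 addr0.
Qed.

Lemma tmapS n m z : (n <= m)%N -> @tmap n m.+1 z = p m (@tmap n m z).
Proof. by move=> nm; rewrite /= tcast_neq ?add0r // ltn_eqF. Qed.

Lemma tmap_comp n m k z : (n <= m)%N -> (m <= k)%N ->
  @tmap m k (@tmap n m z) = @tmap n k z.
Proof.
move=> nm; elim: k => [|k IH].
  by rewrite leqn0 => /eqP m0; subst m; rewrite tmap_id.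
rewrite leq_eqVlt => /predU1P [<-|]; first by rewrite tmap_id.
rewrite ltnS => mk; rewrite tmapS // IH // tmapS //; exact: leq_trans mk.
Qed.

Hypothesis hp : forall n, is_emb (geo n.+1) (p n).

Lemma tmap_emb n m : (n <= m)%N -> is_emb (geo n - geo m) (mklin (@tmap_linear n m)).
Proof.
elim: m => [|m IH].
  rewrite leqn0 => /eqP n0; subst n; rewrite subrr.
  by apply/emb0P => z /=; rewrite tcast_id.
rewrite leq_eqVlt => /predU1P [->|].
  by rewrite subrr; apply/emb0P => z; rewrite [X in `|X|]tmap_id.
rewrite ltnS => nm; have := emb_comp (@hp m) (IH nm).
have -> : geo m.+1 + (geo n - geo m) = geo n - geo m.+1.
  by have := geoS m; lra.
by move=> h z; have := h z; rewrite /= tcast_neq ?add0r // ltn_eqF.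
Qed.

Lemma tmap_emb1 n m : (n <= m)%N -> is_emb 1 (mklin (@tmap_linear n m)).
Proof.
move=> nm; apply: emb_le (tmap_emb nm).
by have := geo_le1 n; have := geo_gt0 m; lra.
Qed.

Lemma tmap_emb_geo n m : (n <= m)%N -> is_emb (geo n) (mklin (@tmap_linear n m)).
Proof.
by move=> nm; apply: emb_le (tmap_emb nm); have := geo_gt0 m; lra.
Qed.

(** The maps [a n] commute with the tower only up to a summable error, because the
    back-and-forth construction yields no more; exact compatibility is the case
    [C = 0]. *)
Record tower_limit (X : normedModType R) (a : forall n, {linear L n -> X}) (C : R) : Prop := {
  tl_emb : forall n, is_emb (geo n) (a n);
  tl_step : forall n z, `|a n.+1 (p n z) - a n z| <= C * geo n * `|z|;
  tl_dense : forall x e, 0 < e ->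
    exists N, forall n, (N <= n)%N -> exists z, `|a n z - x| <= e
}.

Arguments tl_emb [X a C] _ n y.
Arguments tl_step [X a C] _ n z.

Section OneLimit.
Variables (X : normedModType R) (a : forall n, {linear L n -> X}) (C : R).
Hypothesis aX : tower_limit a C.
Hypothesis C0 : 0 <= C.

Lemma tl_emb1 n : is_emb 1 (a n).
Proof. by apply: emb_le (tl_emb aX n); exact: geo_le1. Qed.

(** Telescoping sum: step [k] contributes at most [C * geo k * expR 1 * `|z|], and
    [geo k = 2 * (geo k - geo k.+1)]. *)
Lemma tl_steps n m z : (n <= m)%N ->
  `|a m (@tmap n m z) - a n z| <= 2 * C * expR 1 * (geo n - geo m) * `|z|.
Proof.
elim: m => [|m IH].
  by rewrite leqn0 => /eqP n0; subst n; rewrite tmap_id !subrr normr0 mulr0 mul0r.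
rewrite leq_eqVlt => /predU1P [<-|]; first by rewrite tmap_id !subrr normr0 mulr0 mul0r.
rewrite ltnS => nm; rewrite tmapS //.
rewrite (le_trans (ler_distD (a m (@tmap n m z)) _ _)) //.
apply: le_trans (lerD (tl_step aX _ _) (IH nm)) _.
have h1 : `|@tmap n m z| <= expR 1 * `|z| by exact: emb_ub (tmap_emb1 nm).
have h2 : C * geo m * `|@tmap n m z| <= C * geo m * (expR 1 * `|z|).
  by rewrite ler_wpM2l // mulr_ge0 // ltW // geo_gt0.
apply: le_trans (lerD h2 (lexx _)) _; rewrite geoS; lra.
Qed.

End OneLimit.
Arguments tl_emb1 [X a C] _ n y.

Section TwoLimits.
Variables (X Y : normedModType R) (a : forall n, {linear L n -> X})
  (b : forall n, {linear L n -> Y}).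

(** The isometry between two limits is obtained as a relation, because the threads
    [z] that represent a given [x] are far from unique. *)
Definition limit_rel (x : X) (y : Y) : Prop := exists z : forall n, L n,
  a n (z n) @[n --> \oo] --> x /\ b n (z n) @[n --> \oo] --> y.

Variable C : R.
Hypotheses (aX : tower_limit a C) (bY : tower_limit b C).

Lemma limit_rel_lin r x y x' y' : limit_rel x y -> limit_rel x' y' ->
  limit_rel (r *: x + x') (r *: y + y').
Proof.
move=> [z [ax byl]] [z' [ax' by']]; exists (fun n => r *: z n + z' n).
split.
  have -> : (fun n => a n (r *: z n + z' n)) = (fun n => r *: a n (z n) + a n (z' n)).
    by apply/funext => n; rewrite linearP.
  by apply: cvgD => //; exact: cvgZr.
have -> : (fun n => b n (r *: z n + z' n)) = (fun n => r *: b n (z n) + b n (z' n)).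
  by apply/funext => n; rewrite linearP.
by apply: cvgD => //; exact: cvgZr.
Qed.

(** The distortion of [a n] and [b n] tends to 0. Applied to differences, the
    inequality shows that the relation is single-valued. *)
Lemma limit_rel_le x y : limit_rel x y -> `|y| <= `|x|.
Proof.
move=> [z [ax byl]]; apply: le_expR_eps => // e e0.
have e2 : 0 < e / 2 by rewrite divr_gt0.
have [N hN] := geo_small e2.
have c1 : expR e * `|a n (z n)| @[n --> \oo] --> expR e * `|x|.
  by apply: cvgMl_tmp; exact: cvg_norm.
apply: (ler_cvg_to (cvg_norm byl) c1).
exists N => // n /= /hN ge.
have h1 := emb_ub (z n) (emb_le ge (tl_emb bY n)).
have h2 := emb_lb (z n) (emb_le ge (tl_emb aX n)).
apply: (le_trans h1); rewrite [e in leRHS]splitr expRD -mulrA ler_wpM2l //.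
Qed.

(** Choose [z n] such that [a n (z n)] is a nearly closest point to [x]. *)
Lemma approx_thread (x : X) : exists z : forall n, L n,
  a n (z n) @[n --> \oo] --> x.
Proof.
pose D n := [set `|a n z - x| | z in [set: L n]].
have D0 n : D n !=set0 by exists `|a n 0 - x|; exists 0.
have Dlb n : has_lbound (D n) by exists 0 => _ [z _ <-].
have hz n : exists z, `|a n z - x| < inf (D n) + geo n.
  have [//|_ [z _ <-] hz] := inf_adherent (geo_gt0 n) (_ : has_inf (D n)).
  by exists z.
exists (fun n => projT1 (cid (hz n))); apply/cvgrPdist_le => e e0.
have e2 : 0 < e / 2 by rewrite divr_gt0.
have [N1 hN1] := geo_small e2; have [N2 hN2] := tl_dense aX x e2.
exists (maxn N1 N2) => // n /=; rewrite geq_max => /andP[/hN1 h1 /hN2 [u hu]].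
case: cid => z /= hzn; rewrite distrC; apply: ltW; apply: (lt_le_trans hzn).
rewrite [leRHS]splitr lerD // (le_trans _ hu) // ge_inf //.
by exists u.
Qed.

End TwoLimits.

Section Uniqueness.
Variables (X : normedModType R) (Y : completeNormedModType R)
  (a : forall n, {linear L n -> X}) (b : forall n, {linear L n -> Y}).
Variable C : R.
Hypotheses (C0 : 0 <= C) (aX : tower_limit a C) (bY : tower_limit b C).

(** Push [z n] to a later stage [m]. The result is close to [z m], since both have
    nearly the same image [x] in [X]; therefore their images in [Y] are close too,
    and the sequence [b n (z n)] is Cauchy. *)
Lemma limit_rel_ex x : exists y, limit_rel a b x y.
Proof.
have [z az] := approx_thread aX x.
suff : cvg (b n (z n) @[n --> \oo]) by move=> h; exists (lim (b n (z n) @[n --> \oo])), z.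
apply: cauchy_cvg; apply: cauchy_exP => e e0.
pose E := expR 1 : R; have E1 : 1 <= E by rewrite -expR0 ler_expR.
have Ep : 0 < E by exact: expR_gt0.
have E0 : 0 <= E by exact: ltW.
pose D := 2 * C * E; have D0 : 0 <= D by rewrite !mulr_ge0.
pose B := E * (`|x| + 1); have B0 : 0 < B.
  by rewrite mulr_gt0 // ltr_wpDl.
(* w below is at distance at most 3 E k from z m; the image in Y multiplies this
   by E and one more error k comes from pushing z n *)
pose k := e / (3 * (E * E) + 2).
have k0 : 0 < k by rewrite divr_gt0 // ltr_wpDl // !mulr_ge0.
have ke : 3 * (E * E) * k + 2 * k = e.
  by rewrite -mulrDl mulrC divfK // gt_eqF // ltr_wpDl // !mulr_ge0.
have [N1 hN1] : exists N, forall n, (N <= n)%N -> D * geo n * B <= k.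
  have kDB : 0 < k / ((D + 1) * B) by rewrite divr_gt0 // mulr_gt0 // ltr_wpDl.
  have [N hN] := geo_small kDB; exists N => n /hN.
  rewrite ler_pdivlMr ?mulr_gt0 ?ltr_wpDl // => h; apply: le_trans h.
  rewrite [leRHS]mulrA ler_wpM2r ?(ltW B0) // mulrC.
  by rewrite ler_wpM2l ?(ltW (geo_gt0 _)) // lerDl.
have [N2 _ hN2] : \forall n \near \oo, `|x - a n (z n)| <= Num.min k 1.
  by move/cvgrPdist_le: az; apply; rewrite lt_min k0 /=.
pose n := maxn N1 N2; exists (b n (z n)).
have h1 := hN1 n (leq_maxl _ _); have h2 := hN2 n (leq_maxr _ _).
exists n => // m /= nm; rewrite -ball_normE /=.
have h3 := hN2 m (leq_trans (leq_maxr _ _) nm).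
move: h2 h3; rewrite /= !le_min => /andP[h2k h21] /andP[h3k _].
have zB : `|z n| <= B.
  apply: (le_trans (emb_lb _ (tl_emb1 aX n))); rewrite /B ler_wpM2l //.
  have := ler_distD x (a n (z n)) 0; rewrite !subr0 distrC addrC => /le_trans; apply.
  by rewrite lerD.
pose w := tmap m (z n).
have err (V : normedModType R) (c : forall n, {linear L n -> V}) :
    tower_limit c C -> `|c m w - c n (z n)| <= k.
  move=> cV; apply: le_trans (tl_steps cV C0 _ nm) _; apply: le_trans h1.
  rewrite -/E -/D ler_pM // ?mulr_ge0 // ?subr_ge0 ?geo_decr //.
  by rewrite ler_wpM2l // lerBlDr lerDl ltW // geo_gt0.
have zw : `|z m - w| <= E * (3 * k).
  apply: (le_trans (emb_lb _ (tl_emb1 aX m))); rewrite ler_wpM2l // linearB.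
  have -> : a m (z m) - a m w = (x - a n (z n)) - (x - a m (z m)) - (a m w - a n (z n)).
    have -> : x - a n (z n) - (x - a m (z m)) = a m (z m) - a n (z n).
      by rewrite opprB addrC addrA subrK.
    by rewrite opprB addrA subrK.
  apply: (le_trans (ler_normB _ _)).
  have := ler_normB (x - a n (z n)) (x - a m (z m)); have := err _ _ aX; lra.
have bzw : `|b m (z m) - b m w| <= E * (E * (3 * k)).
  rewrite -linearB (le_trans (emb_ub _ (tl_emb1 bY m))) //.
  by rewrite ler_wpM2l.
have := ler_distD (b m w) (b m (z m)) (b n (z n)); have := err _ _ bY.
by rewrite [`|b n _ - b m _|]distrC; lra.
Qed.

End Uniqueness.

Theorem tower_limit_unique (X Y : completeNormedModType R)
    (a : forall n, {linear L n -> X}) (b : forall n, {linear L n -> Y}) (C : R) :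
  0 <= C -> tower_limit a C -> tower_limit b C -> isometric X Y.
Proof.
move=> C0 aX bY.
have ex x := limit_rel_ex C0 aX bY x.
pose T x := projT1 (cid (ex x)).
have TP x : limit_rel a b x (T x) by rewrite /T; case: cid.
have rel_sym x y : limit_rel a b x y -> limit_rel b a y x.
  by move=> [z [h1 h2]]; exists z.
have rel_uniq x y y' : limit_rel a b x y -> limit_rel a b x y' -> y = y'.
  move=> h h'; have := limit_rel_lin (-1) h h'.
  rewrite !scaleN1r addNr => /(limit_rel_le aX bY).
  by rewrite normr0 normr_le0 addrC subr_eq0 => /eqP.
have lT : linear T.
  by move=> r x x'; apply: rel_uniq (TP _) _; apply: limit_rel_lin.
exists (mklin lT); split=> [x|y].
  apply/eqP; rewrite eq_le (limit_rel_le aX bY (TP x)).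
  exact: (limit_rel_le bY aX (rel_sym _ _ (TP x))).
have [x [z [bz az]]] := limit_rel_ex C0 bY aX y.
by exists x; apply: rel_uniq (TP x) _; exists z.
Qed.

End Towers.
Arguments tl_emb {R L p X a C} _ n y.
Arguments tl_dense {R L p X a C} _ x [e] _.

(** * Towers of finite-dimensional spaces: existence of the limit *)

Section TowerLimit.
Context {R : realType}.
Variables (L : nat -> fdNormed R) (p : forall n, {linear L n -> L n.+1}).

Local Notation q := (tmap p).

(** The vectors of the completed direct limit are classes of sequences that are
    Cauchy along the tower: direct limit and completion are taken in one step. *)
Record thread := Thread {
  th :> forall n, L n;
  thP : forall e, 0 < e -> exists N, forall n m, (N <= n)%N -> (n <= m)%N ->
    `|th m - q m (th n)| <= e
}.

Lemma thread_ext (z w : thread) : (forall n, z n = w n) -> z = w.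
Proof.
case: z w => z zP [w wP] /= zw; have E : z = w.
  exact: (boolp.functional_extensionality_dep zw).
by subst w; congr Thread; exact: Prop_irrelevance.
Qed.

HB.instance Definition _ := gen_eqMixin thread.
HB.instance Definition _ := gen_choiceMixin thread.

Lemma thread_lin_subproof (r s : R) (z w : thread) e : 0 < e ->
  exists N, forall n m, (N <= n)%N -> (n <= m)%N ->
    `|(r *: z m + s *: w m) - q m (r *: z n + s *: w n)| <= e.
Proof.
move=> e0; pose k := e / (`|r| + `|s| + 1).
have k0 : 0 < k by rewrite divr_gt0 // ltr_wpDl // addr_ge0.
have [N1 h1] := thP z k0; have [N2 h2] := thP w k0.
exists (maxn N1 N2) => n m; rewrite geq_max => /andP[n1 n2] nm.
have -> : r *: z m + s *: w m - q m (r *: z n + s *: w n) =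
    r *: (z m - q m (z n)) + s *: (w m - q m (w n)).
  rewrite -[q m (_ + _)]/(mklin (tmap_linear p (n := n) m) (r *: z n + s *: w n)).
  by rewrite linearD !linearZ /= !scalerBr opprD addrACA.
apply: (le_trans (ler_normD _ _)); rewrite !normrZ.
have r1 : `|r| * `|z m - q m (z n)| <= `|r| * k by rewrite ler_wpM2l // h1.
have s1 : `|s| * `|w m - q m (w n)| <= `|s| * k by rewrite ler_wpM2l // h2.
apply: (le_trans (lerD r1 s1)); rewrite -mulrDl.
have -> : e = (`|r| + `|s| + 1) * k.
  by rewrite /k mulrC divfK // gt_eqF // ltr_wpDl // addr_ge0.
by rewrite ler_wpM2r ?(ltW k0) // lerDl.
Qed.

Definition thread_comb (r s : R) (z w : thread) : thread :=
  @Thread (fun n => r *: z n + s *: w n) (thread_lin_subproof r s z w).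

Lemma thread_push_subproof n (u : L n) e : 0 < e ->
  exists N, forall k m, (N <= k)%N -> (k <= m)%N ->
    `|q m u - q m (q k u)| <= e.
Proof.
by move=> e0; exists n => k m nk km; rewrite tmap_comp // subrr normr0 ltW.
Qed.

Definition thread_push n (u : L n) : thread :=
  @Thread (fun m => q m u) (thread_push_subproof u).

Definition thread0 := thread_push (0 : L 0).

Lemma thread0E n : thread0 n = 0.
Proof. exact: (linear0 (mklin (tmap_linear p (n := 0) n))). Qed.

Definition threadD z w := thread_comb 1 1 z w.
Definition threadN z := thread_comb (-1) 0 z z.
Definition threadZ r z := thread_comb r 0 z z.

Let tDE z w n : threadD z w n = z n + w n.
Proof. by rewrite /threadD /= !scale1r. Qed.
Let tNE z n : threadN z n = - z n.
Proof. by rewrite /threadN /= scaleN1r scale0r addr0. Qed.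
Let tZE r z n : threadZ r z n = r *: z n.
Proof. by rewrite /threadZ /= scale0r addr0. Qed.

Let tDA : associative threadD.
Proof. by move=> x y z; apply: thread_ext => n; rewrite !tDE addrA. Qed.
Let tDC : commutative threadD.
Proof. by move=> x y; apply: thread_ext => n; rewrite !tDE addrC. Qed.
Let tD0 : left_id thread0 threadD.
Proof. by move=> x; apply: thread_ext => n; rewrite tDE thread0E add0r. Qed.
Let tDN : left_inverse thread0 threadN threadD.
Proof. by move=> x; apply: thread_ext => n; rewrite tDE tNE thread0E addNr. Qed.

HB.instance Definition _ := GRing.isZmodule.Build thread tDA tDC tD0 tDN.

Let tZA r s z : threadZ r (threadZ s z) = threadZ (r * s) z.
Proof. by apply: thread_ext => n; rewrite !tZE scalerA. Qed.
Let tZ1 : left_id 1 threadZ.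
Proof. by move=> x; apply: thread_ext => n; rewrite tZE scale1r. Qed.
Let tZDr : right_distributive threadZ +%R.
Proof. by move=> r x y; apply: thread_ext => n; rewrite !(tZE, tDE) scalerDr. Qed.
Let tZDl x : {morph threadZ^~ x : r s / r + s}.
Proof. by move=> r s; apply: thread_ext => n; rewrite !(tZE, tDE) scalerDl. Qed.

HB.instance Definition _ :=
  GRing.Zmodule_isLmodule.Build R thread tZA tZ1 tZDr tZDl.

Lemma thDE (z w : thread) n : (z + w) n = z n + w n. Proof. exact: tDE. Qed.
Lemma thNE (z : thread) n : (- z) n = - z n. Proof. exact: tNE. Qed.
Lemma thZE r (z : thread) n : (r *: z) n = r *: z n. Proof. exact: tZE. Qed.

Lemma th_linear n : linear (fun z : thread => z n).
Proof. by move=> r z w; rewrite thDE thZE. Qed.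

Lemma thread_push_linear n : linear (@thread_push n).
Proof.
by move=> r u v; apply: thread_ext => m; rewrite thDE thZE /= tmap_linear.
Qed.

Hypothesis hp : forall n, is_emb (geo n.+1) (p n).

Let NN n : seminorm thread := lin_seminorm (mklin (th_linear n)).

Lemma thread_bounded (z : thread) : exists B, forall n, NN n z <= B.
Proof.
have [N hN] := thP z ltr01.
exists (\sum_(k < N) `|z k| + (1 + expR 1 * `|z N|)) => n.
rewrite /NN lin_seminormE /=; have [nN|Nn] := ltnP n N.
  rewrite (bigD1 (Ordinal nN)) //= -addrA lerDl.
  by rewrite !addr_ge0 ?sumr_ge0 ?mulr_ge0 ?expR_ge0.
rewrite (le_trans _ (_ : 1 + expR 1 * `|z N| <= _)) ?lerDr ?sumr_ge0 //.
have := hN N n (leqnn _) Nn; have := emb_ub (z N) (tmap_emb1 hp Nn).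
rewrite /= => h1 h2; rewrite -[z n](subrK (q n (z N))).
by apply: (le_trans (ler_normD _ _)); rewrite lerD.
Qed.

(** The limit is the space of threads with the seminorm [lim `|z n|], divided by its
    kernel. A thread [z] is approximated by its own terms [z n], pushed along the
    tower; so a Cauchy filter is approximated by vectors [u n] of [L n], and these
    vectors form the thread to which the filter converges. *)
Theorem tower_limit_exists :
  exists (X : completeNormedModType R) (a : forall n, {linear L n -> X}),
    tower_limit p a 0.
Proof.
have [U [UU sU]] := free_ultrafilter.
have [lim_sn hlim] := seminorm_ultralimit UU thread_bounded.
pose Q : normedModType R := squot lim_sn.
pose a n : {linear L n -> Q} := sproj lim_sn \o mklin (@thread_push_linear n).
have lim_le (z : thread) N c : (forall n, (N <= n)%N -> `|z n| <= c) -> lim_sn z <= c.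
  move=> h; apply: cvgr_to_le (hlim z) _; apply: sU.
  by exists N => // n; exact: h.
have lim_ge (z : thread) N c : (forall n, (N <= n)%N -> c <= `|z n|) -> c <= lim_sn z.
  move=> h; apply: cvgr_to_ge (hlim z) _; apply: sU.
  by exists N => // n; exact: h.
have a_emb n : is_emb (geo n) (a n).
  apply: embP => u; rewrite /= norm_sproj.
    apply: (lim_le _ n) => m nm; exact: emb_ub (tmap_emb_geo hp nm).
  rewrite -ler_pdivrMl ?expR_gt0 //.
  apply: (lim_ge _ n) => m nm; rewrite ler_pdivrMl ?expR_gt0 //.
  exact: emb_lb (tmap_emb_geo hp nm).
have a_step n u : a n.+1 (p n u) = a n u.
  apply/sproj_eq/eqP; rewrite eq_le sn_ge0 andbT.
  apply: (lim_le _ n.+1) => m nm; rewrite thDE thNE /=.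
  have -> : p n u = q n.+1 u by rewrite tmapS // tmap_id.
  by rewrite tmap_comp // subrr normr0.
have a_approx (z : thread) e : 0 < e -> exists N, forall n, (N <= n)%N ->
    `|a n (z n) - sproj lim_sn z| <= e.
  move=> e0; have [N hN] := thP z e0; exists N => n Nn.
  rewrite /= -linearB norm_sproj; apply: (lim_le _ n) => m nm.
  by rewrite thDE thNE /= distrC hN.
have a_steps n m u : (n <= m)%N -> a m (q m u) = a n u.
  elim: m => [|m IH]; first by rewrite leqn0 => /eqP n0; subst n; rewrite tmap_id.
  rewrite leq_eqVlt => /predU1P [<-|]; first by rewrite tmap_id.
  by rewrite ltnS => nm; rewrite tmapS // a_step IH.
have a_emb1 n : is_emb 1 (a n) by apply: emb_le (@a_emb n); exact: geo_le1.
have Qcomplete (F : set_system Q) : ProperFilter F -> cauchy F -> cvg F.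
  move=> FF /cauchyP Fc.
  (* radii of the balls that belong to F and are centred at the image of L n *)
  pose D n := [set r | exists u : L n, F (ball (a n u) r)].
  have Dlb n : has_lbound (D n).
    exists 0 => r [u Fu]; rewrite leNgt; apply/negP => r0.
    have [y] := filter_ex Fu; rewrite -ball_normE /= => h.
    by have := lt_trans (le_lt_trans (normr_ge0 _) h) r0; rewrite ltxx.
  have Dle n x e u : F (ball x e) -> `|a n u - x| <= e -> inf (D n) <= e + e.
    move=> Fx h; apply: ge_inf => //; exists u; apply: filterS Fx => y.
    rewrite -!ball_normE /= => xy.
    by rewrite (le_lt_trans (ler_distD x _ _)) // ler_ltD.
  have D0 n : D n !=set0.
    have [x Fx] := Fc 1 ltr01; exists (`|x| + 1), 0; rewrite linear0; apply: filterS Fx => y.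
    rewrite -!ball_normE /= => xy.
    by rewrite (le_lt_trans (ler_distD x _ _)) // sub0r normrN ler_ltD.
  have hu n : exists ur : L n * R, F (ball (a n ur.1) ur.2) /\ ur.2 < inf (D n) + geo n.
    have [//|r [u Fu] hr] := inf_adherent (geo_gt0 n) (_ : has_inf (D n)).
    by exists (u, r).
  pose u n := (projT1 (cid (hu n))).1; pose r n := (projT1 (cid (hu n))).2.
  have Fu n : F (ball (a n (u n)) (r n)) by rewrite /u /r; case: cid => ? [].
  have ru n : r n < inf (D n) + geo n by rewrite /u /r; case: cid => ? [].
  have r_small e : 0 < e -> exists N, forall n, (N <= n)%N -> r n <= e.
    move=> e0; have e4 : 0 < e / 4 by rewrite divr_gt0.
    have [N1 hN1] := geo_small e4.
    have [x Fx] := Fc _ e4; have [w wx] := sproj_surj x.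
    have [N2 hN2] := a_approx w _ e4.
    exists (maxn N1 N2) => n; rewrite geq_max => /andP[/hN1 h1 /hN2 h2].
    rewrite wx in h2; have := Dle n x _ _ Fx h2; have := ru n; lra.
  have close n m : `|a n (u n) - a m (u m)| <= r n + r m.
    have [y [/= h1 h2]] := filter_ex (filterI (Fu n) (Fu m)).
    move: h1 h2; rewrite -!ball_normE /= => h1 h2.
    apply: (le_trans (ler_distD y _ _)); rewrite [`|y - _|]distrC lerD // ltW //.
  have uP e : 0 < e -> exists N, forall n m, (N <= n)%N -> (n <= m)%N ->
      `|u m - q m (u n)| <= e.
    move=> e0; pose k := e / (expR 1 * 2).
    have k0 : 0 < k by rewrite divr_gt0 // mulr_gt0 // expR_gt0.
    have [N hN] := r_small k k0; exists N => n m Nn nm.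
    apply: (le_trans (emb_lb _ (@a_emb1 m))); rewrite linearB a_steps //.
    have -> : e = expR 1 * (2 * k).
      by rewrite mulrA /k mulrC divfK // gt_eqF // mulr_gt0 // expR_gt0.
    rewrite ler_wpM2l ?expR_ge0 // (le_trans (close _ _)) //.
    have := hN n Nn; have := hN m (leq_trans Nn nm); lra.
  pose z := Thread uP; apply/cvg_ex; exists (sproj lim_sn z).
  apply/cvgrPdist_le => e e0; have e2 : 0 < e / 2 by rewrite divr_gt0.
  have [N1 hN1] := a_approx z _ e2; have [N2 hN2] := r_small _ e2.
  pose n := maxn N1 N2.
  have h1 := hN1 n (leq_maxl _ _); have h2 := hN2 n (leq_maxr _ _).
  apply: filterS (Fu n) => y; rewrite -ball_normE /= => h3.
  rewrite distrC in h1.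
  rewrite (le_trans (ler_distD (a n (u n)) _ _)) // [leRHS]splitr lerD //.
  exact: le_trans (ltW h3) h2.
pose X : completeNormedModType R := HB.pack (squot lim_sn : Type)
  (normed_module.NormedModule.on Q) (Uniform_isComplete.Build Q Qcomplete).
exists X, a; split=> //.
- by move=> n u; rewrite a_step subrr normr0 !mul0r.
- move=> x e e0; have [w <-] := sproj_surj x.
  have [N hN] := a_approx w e e0; exists N => n /hN h.
  by exists (w n).
Qed.

End TowerLimit.

(** * A guarded Fraisse space is determined by its closed age *)

Section BackAndForthArgument.
Context {R : realType}.

Lemma dependent_choice_seq (T : Type) (P : nat -> T -> Prop) (S : nat -> T -> T -> Prop) :
  (exists s, P 0 s) ->
  (forall n s, P n s -> exists s', P n.+1 s' /\ S n s s') ->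
  exists f : nat -> T, forall n, P n (f n) /\ S n (f n) (f n.+1).
Proof.
move=> [s0 Ps0] step.
pose g := fix g n : {s | P n s} := match n with
  | 0 => exist _ s0 Ps0
  | k.+1 => let: c := cid (step k (sval (g k)) (svalP (g k))) in
            exist _ (projT1 c) (projT2 c).1
  end.
exists (fun n => sval (g n)) => n; split; first exact: (svalP (g n)).
by rewrite /=; case: cid => s [].
Qed.

Lemma dense_sequence (X : normedModType R) : separable X ->
  exists x : nat -> X, forall y e, 0 < e -> exists i, `|x i - y| <= e.
Proof.
move=> [D /countable_injP [f finj] Dd].
pose P n z := D z /\ f z = n.
exists (fun n => if pselect (exists z, P n z) is left h then projT1 (cid h) else 0).
move=> y e e0; have [||z [yz Dz]] := Dd (ball y e).
- by exists y; exact: ballxx.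
- exact: ball_open.
exists (f z); case: pselect => [h|[]]; last by exists z.
case: cid => w /= [Dw fw].
have -> : w = z by apply: finj => //; rewrite inE.
by move: yz; rewrite -ball_normE /= distrC => /ltW.
Qed.

(** [F] guards [A] in [P] and is sent to [Q]. The space [B] is spanned in [Q] by the
    image of [F] and by prescribed vectors, and [G] guards it. As [G] lies in the
    closed age of [P] too, the guard [F] sends it back to [P], nearly fixing [A]. *)
Lemma half_step (P Q : normedModType R) (A F D0 : fdNormed R) (a : {linear A -> P})
    (phi : {linear A -> F}) (d c e : R) (alpha : {linear F -> Q}) (u0 : {linear D0 -> Q}) :
  gF2 Q -> (forall E, age_cl Q E -> age_cl P E) ->
  guard a phi d c -> is_emb (d / 2) alpha -> 0 < d -> 0 < e ->
  exists (B : fdNormed R) (b : {linear B -> Q}) (k : {linear F -> B})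
    (G : fdNormed R) (chi : {linear B -> G}) (d' : R) (beta : {linear G -> P}),
    [/\ is_emb 0 b, (forall x, b (k x) = alpha x), (forall v, exists y, b y = u0 v),
        is_emb e chi & 0 < d'] /\
    [/\ guard b chi d' e, is_emb (d' / 2) beta, is_emb e beta &
        forall x, `|a x - beta (chi (k (phi x)))| <= c * `|x|].
Proof.
move=> gQ QP ga halpha d0 e0.
pose D := FdNormed (fd_prod F D0).
pose w (z : D) : Q := alpha z.1 + u0 z.2.
have lw : linear w by move=> r x y; rewrite /w !linearP scalerDr addrACA.
have [V [S [VS _]]] := image_subspace (mklin lw).
have linl : linear (fun x : F => (x, 0) : D).
  by move=> r x y; congr (_, _); rewrite /= scaler0 addr0.
have m0 : 0 < Num.min e (d / 2) by rewrite lt_min e0 divr_gt0.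
have [G [chi [d' [KG hchi d'0 gb]]]] := gF2_guard gQ (@fds_incl_emb _ _ V) m0.
rewrite addr0 in hchi; rewrite expR0 mulr1 in gb.
pose k := S \o mklin linl.
have bk x : fds_inj V (k x) = alpha x by rewrite VS /= /w /= linear0 addr0.
have hk : is_emb (d / 2) k by move=> x; have := halpha x; rewrite -bk.
have eta0 : 0 < Num.min (d' / 2) e by rewrite lt_min e0 divr_gt0.
have hpsi : is_emb d (chi \o k).
  rewrite [d]splitr; apply: emb_comp hk; apply: emb_le hchi.
  by rewrite ge_min lexx orbT.
have [beta hbeta hab] := ga G _ _ (QP _ KG) hpsi eta0.
exists (fds_space V), (fds_inj V), k, G, chi, d', beta; split; split=> //.
- exact: fds_incl_emb.
- by move=> v; exists (S (0, v)); rewrite VS /= /w /= linear0 add0r.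
- by apply: emb_le hchi; rewrite ge_min lexx.
- move=> H psi eta KH hpsi' eta'0; have [i hi hx] := gb H psi eta KH hpsi' eta'0.
  exists i => // x; apply: (le_trans (hx x)); rewrite ler_wpM2r //.
  by rewrite ge_min lexx.
- by apply: emb_le hbeta; rewrite ge_min lexx.
- by apply: emb_le hbeta; rewrite ge_min lexx orbT.
Qed.

Section BackAndForth.
Variables X Y : completeNormedModType R.
Hypotheses (gX : gF2 X) (gY : gF2 Y).
Hypothesis XY : forall E, age_cl X E <-> age_cl Y E.
Variables (x : nat -> X) (y : nat -> Y).
Hypothesis x_dense : forall z e, 0 < e -> exists i, `|x i - z| <= e.
Hypothesis y_dense : forall z e, 0 < e -> exists i, `|y i - z| <= e.

(* four embeddings of distortion eps n compose to a map of the tower, whose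
   distortion is at most geo n.+1 = 4 * eps n *)
Let eps n : R := geo n / 8.
Let eps_gt0 n : 0 < eps n. Proof. by rewrite divr_gt0 // geo_gt0. Qed.

(** The composites [sA -> sF -> sB -> sG], together with maps to [X] from [sA] and
    [sG] and to [Y] from [sF] and [sB]. The tower is made of the spaces [sF]. *)
Record bf_state := BfState {
  sA : fdNormed R; sF : fdNormed R; sB : fdNormed R; sG : fdNormed R;
  sa : {linear sA -> X}; sphi : {linear sA -> sF}; salpha : {linear sF -> Y};
  sk : {linear sF -> sB}; sb : {linear sB -> Y}; schi : {linear sB -> sG};
  sbeta : {linear sG -> X}; sd : R
}.

Definition sc (s : bf_state) : {linear sF s -> X} := sbeta s \o (schi s \o sk s).

Record bf_valid (n : nat) (s : bf_state) : Prop := {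
  bf_a : is_emb 0 (sa s);
  bf_b : is_emb 0 (sb s);
  bf_k : forall z, sb s (sk s z) = salpha s z;
  bf_phi : is_emb (eps n) (sphi s);
  bf_alpha : is_emb (eps n) (salpha s);
  bf_chi : is_emb (eps n) (schi s);
  bf_beta : is_emb (eps n) (sbeta s);
  bf_d : 0 < sd s;
  bf_beta_d : is_emb (sd s / 2) (sbeta s);
  bf_guard : guard (sb s) (schi s) (sd s) (eps n);
  bf_ac : forall z, `|sa s z - sc s (sphi s z)| <= eps n * `|z|;
  bf_x : forall i, (i < n)%N -> exists z, sa s z = x i;
  bf_y : forall i, (i < n)%N -> exists z, sb s z = y i
}.

Definition bf_succ (n : nat) (s s' : bf_state) : Prop :=
  exists k : {linear sG s -> sA s'}, (forall z, sa s' (k z) = sbeta s z) /\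
    forall z, `|sb s z - salpha s' (sphi s' (k (schi s z)))| <= eps n * `|z|.

Lemma bf_next n (A F : fdNormed R) (a : {linear A -> X}) (phi : {linear A -> F})
    (alpha : {linear F -> Y}) (d : R) :
  is_emb 0 a -> is_emb (eps n) phi -> is_emb (eps n) alpha -> is_emb (d / 2) alpha ->
  0 < d -> guard a phi d (eps n) -> (forall i, (i < n)%N -> exists z, a z = x i) ->
  exists (B G : fdNormed R) k b chi beta d',
    bf_valid n (@BfState A F B G a phi alpha k b chi beta d').
Proof.
move=> ha hphi halpha hd d0 ga xa.
pose D0 := FdNormed (@fd_row R n).
pose u0 : {linear D0 -> Y} := lincomb (fun i : 'I_n => y i).
have [E /XY //|B [b [k [G [chi [d' [beta [[hb bk yb hchi d'0] [gb hbd hbe hab]]]]]]]]] :=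
  @half_step X Y A F D0 a phi d _ (eps n) alpha u0 gY _ ga hd d0 (eps_gt0 n).
exists B, G, k, b, chi, beta, d'; split=> // i ni.
have [z hz] := yb (delta_mx 0 (Ordinal ni)).
by exists z; rewrite hz [u0 _]lincomb_delta.
Qed.

Lemma bf_init : exists s, bf_valid 0 s.
Proof.
pose A := FdNormed (@fd_row R 0).
have ha : is_emb 0 (lin0 A X).
  apply/emb0P => z; have -> : z = 0 by apply/rowP => -[].
  by rewrite linear0 !normr0.
have [F [phi [d [KF hphi d0 ga]]]] := gF2_guard gX ha (eps_gt0 0).
rewrite addr0 in hphi; rewrite expR0 mulr1 in ga.
have /XY /age_clP KF' := KF.
have m0 : 0 < Num.min (d / 2) (eps 0) by rewrite lt_min divr_gt0 //=.
have [alpha halpha] := KF' _ m0.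
have [||//|B [G [k [b [chi [beta [d' h]]]]]]] :=
  @bf_next 0 A F (lin0 A X) phi alpha d ha hphi _ _ d0 ga.
- by apply: emb_le halpha; rewrite ge_min lexx orbT.
- by apply: emb_le halpha; rewrite ge_min lexx.
by eexists; exact: h.
Qed.

Lemma bf_step n s : bf_valid n s -> exists s', bf_valid n.+1 s' /\ bf_succ n s s'.
Proof.
move=> hs; pose D0 := FdNormed (@fd_row R n.+1).
pose u0 : {linear D0 -> X} := lincomb (fun i : 'I_n.+1 => x i).
have [E /XY //|A [a [k [F [phi [d [alpha [[ha ak xa hphi d0] [ga had hae hba]]]]]]]]] :=
  @half_step Y X (sB s) (sG s) D0 (sb s) (schi s) (sd s) (eps n) (eps n.+1) (sbeta s) u0
    gX _ (@bf_guard _ _ hs) (@bf_beta_d _ _ hs) (bf_d hs) (eps_gt0 n.+1).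
have [i ni|B [G [kk [b [chi [beta [d' h]]]]]]] :=
  @bf_next n.+1 A F a phi alpha d ha hphi hae had d0 ga.
  have [z hz] := xa (delta_mx 0 (Ordinal ni)).
  by exists z; rewrite hz [u0 _]lincomb_delta.
by eexists; split; [exact: h | exists k].
Qed.

(** Consecutive states compose to a tower of spaces [sF]. Its maps to [X] and to [Y]
    commute with the tower up to summable errors, because the guards nearly fix
    [sA] and [sB]; they have dense range in the limit because these contain more
    and more terms of the dense sequences. So [X] and [Y] are limits of one tower. *)
Lemma bf_isometric : isometric X Y.
Proof.
have [f hf] := dependent_choice_seq bf_init bf_step.
have V n := (hf n).1.
pose k n := projT1 (cid (hf n).2).
have ak n z : sa (f n.+1) (k n z) = sbeta (f n) z.
  by rewrite /k; case: cid => ? [].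
have b_alpha n z : `|sb (f n) z - salpha (f n.+1) (sphi (f n.+1) (k n (schi (f n) z)))|
    <= eps n * `|z|.
  by rewrite /k; case: cid => ? [].
pose L n := sF (f n).
pose p n : {linear L n -> L n.+1} :=
  sphi (f n.+1) \o (k n \o (schi (f n) \o sk (f n))).
have eps1 n : eps n <= 1 / 8 by have := @geo_le1 R n; rewrite /eps; lra.
have a_iso n z : `|sa (f n) z| = `|z| := (emb0P _).1 (@bf_a _ _ (V n)) z.
have b_iso n z : `|sb (f n) z| = `|z| := (emb0P _).1 (@bf_b _ _ (V n)) z.
have hk n : is_emb (eps n) (k n).
  by move=> z; have := @bf_beta _ _ (V n) z; rewrite -ak a_iso.
have hsk n : is_emb (eps n) (sk (f n)).
  move=> z; have := @bf_alpha _ _ (V n) z.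
  by rewrite -(bf_k (V n)) b_iso.
have hp n : is_emb (geo n.+1) (p n).
  have := emb_comp (@bf_phi _ _ (V n.+1)) (emb_comp (@hk n)
    (emb_comp (@bf_chi _ _ (V n)) (@hsk n))).
  by apply: emb_le; rewrite /eps !geoS; have := @geo_gt0 R n; lra.
have hsc n : is_emb (eps n + (eps n + eps n)) (sc (f n)).
  exact: emb_comp (@bf_beta _ _ (V n)) (emb_comp (@bf_chi _ _ (V n)) (@hsk n)).
have eps_geo n : eps n <= geo n by rewrite /eps; have := @geo_gt0 R n; lra.
have bnd n : eps n <= expR 1 * geo n.
  apply: (le_trans (eps_geo n)); rewrite -{1}[geo n]mul1r ler_wpM2r //.
    by rewrite ltW // geo_gt0.
  by rewrite -expR0 ler_expR.
have limX : tower_limit p (fun n => sc (f n)) (expR 1).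
  split=> [n|n z|z e e0].
  - by apply: emb_le (@hsc n); rewrite /eps; have := @geo_gt0 R n; lra.
  - have -> : sc (f n) z = sa (f n.+1) (k n (schi (f n) (sk (f n) z))) by rewrite ak.
    rewrite distrC; apply: (le_trans (bf_ac (V n.+1) _)).
    have -> : `|k n (schi (f n) (sk (f n) z))| = `|sc (f n) z|.
      by rewrite -a_iso ak.
    have h1 := emb_ub z (@hsc n).
    have h2 : expR (eps n + (eps n + eps n)) <= expR 1.
      by rewrite ler_expR; have := eps1 n; lra.
    have h3 : `|sc (f n) z| <= expR 1 * `|z| by rewrite (le_trans h1) // ler_wpM2r.
    apply: (le_trans (ler_wpM2l (ltW (eps_gt0 _)) h3)).
    rewrite mulrA ler_wpM2r // mulrC ler_wpM2l ?expR_ge0 //.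
    by apply: (le_trans (eps_geo _)); exact: geo_decr.
  - have e2 : 0 < e / 2 by rewrite divr_gt0.
    have [i hi] := x_dense z e2.
    have e3 : 0 < e / 2 / (`|x i| + 1) by rewrite divr_gt0 // ltr_wpDl.
    have [N hN] := geo_small e3; exists (maxn N i.+1) => n.
    rewrite geq_max => /andP[/hN gn ni].
    have [w hw] := bf_x (V n) ni; exists (sphi (f n) w).
    apply: (le_trans (ler_distD (x i) _ _)); rewrite [leRHS]splitr lerD //.
    rewrite -hw distrC; apply: (le_trans (bf_ac (V n) w)).
    rewrite -(a_iso n w) hw.
    move: gn; rewrite ler_pdivlMr ?ltr_wpDl // => gn; apply: le_trans gn.
    by rewrite ler_pM // ?lerDl // ltW.
have limY : tower_limit p (fun n => salpha (f n)) (expR 1).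
  split=> [n|n z|z e e0].
  - by apply: emb_le (@bf_alpha _ _ (V n)).
  - rewrite -(bf_k (V n)) distrC; apply: (le_trans (b_alpha n _)).
    have -> : `|sk (f n) z| = `|salpha (f n) z|.
      by rewrite -(bf_k (V n)) b_iso.
    have h3 : `|salpha (f n) z| <= expR 1 * `|z|.
      by apply: emb_ub; apply: emb_le (@bf_alpha _ _ (V n)); have := eps1 n; lra.
    apply: (le_trans (ler_wpM2l (ltW (eps_gt0 _)) h3)).
    rewrite mulrA ler_wpM2r // mulrC ler_wpM2l ?expR_ge0 //.
  - have e2 : 0 < e / 2 by rewrite divr_gt0.
    have [i hi] := y_dense z e2.
    have e3 : 0 < e / 2 / (`|y i| + 1) by rewrite divr_gt0 // ltr_wpDl.
    have [N hN] := geo_small e3; exists (maxn N i.+1).+1 => -[//|n].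
    rewrite ltnS geq_max => /andP[/hN gn ni].
    have [w hw] := bf_y (V n) ni.
    exists (sphi (f n.+1) (k n (schi (f n) w))).
    apply: (le_trans (ler_distD (y i) _ _)); rewrite [leRHS]splitr lerD //.
    rewrite -hw distrC; apply: (le_trans (b_alpha n w)).
    rewrite -(b_iso n w) hw.
    move: gn; rewrite ler_pdivlMr ?ltr_wpDl // => gn; apply: le_trans gn.
    by rewrite ler_pM // ?lerDl // ltW.
exact: (tower_limit_unique hp (expR_ge0 1) limX limY).
Qed.

End BackAndForth.

Theorem gF2_isometric (X Y : completeNormedModType R) :
  separable X -> separable Y -> gF2 X -> gF2 Y -> age_cl X = age_cl Y -> isometric X Y.
Proof.
move=> /dense_sequence [x hx] /dense_sequence [y hy] gX gY XY.
by apply: (bf_isometric gX gY _ hx hy) => E; rewrite XY.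
Qed.

End BackAndForthArgument.

(** * The extensions of a space inside a class form a separable family *)

Section Separability.
Context {R : realType}.

(** A basis of the range of [T] is completed to a basis of [H]: with [M = L P U] from
    Gaussian elimination, where [P] is a partial identity, the rows of
    [block_mx L 0 0 1 *m U] extend those of [M]. *)
Lemma extend_coordinates k (H : fdNormed R) (T : {linear 'rV[R]_k -> H}) :
  injective T -> exists d (b : {linear 'rV[R]_(k + d) -> H}),
    bijective b /\ forall v, b (row_mx v 0) = T v.
Proof.
move=> Tinj; have [m [g [f gf fg]]] := fd_param (fd_finite_dim H).
have flin m' (g' : {linear 'rV[R]_m' -> H}) (f' : H -> 'rV[R]_m') :
    cancel g' f' -> cancel f' g' -> linear f'.
  by move=> gf' fg' r x y; rewrite -{1}(fg' x) -{1}(fg' y) -linearP gf'.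
have km : (k <= m)%N.
  apply: (@row_injective_dim _ k m (mklin (flin _ _ _ gf fg) \o T)).
  by move=> u v /(can_inj fg) /Tinj.
pose d := (m - k)%N; have md : m = (k + d)%N by rewrite subnKC.
move: g f gf fg; rewrite md => g f gf fg.
pose S : {linear 'rV[R]_k -> 'rV[R]_(k + d)} := mklin (flin _ _ _ gf fg) \o T.
have Sinj : injective S by move=> u v /(can_inj fg) /Tinj.
pose M := lin1_mx S.
have rM : \rank M = k.
  apply/eqP; rewrite -/(row_free M) -kermx_eq0 -submx0; apply/rV_subP => v /sub_kermxP.
  rewrite mul_rV_lin1 => Sv; rewrite submx0; apply/eqP/Sinj.
  by rewrite Sv linear0.
pose W : 'M[R]_(k + d) := block_mx (col_ebase M) 0 0 1%:M *m row_ebase M.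
have Wu : W \in unitmx.
  rewrite unitmx_mul row_ebase_unit andbT unitmxE det_lblock det1 mulr1.
  by rewrite -unitmxE col_ebase_unit.
exists d, (g \o mulmxr W); split.
  exists (fun h => f h *m invmx W) => [v|h] /=; first by rewrite gf mulmxK.
  by rewrite mulmxKV // fg.
move=> v; rewrite /= /W mulmxA mul_row_block !mul0mx !mulmx0 !addr0.
have -> : T v = g (S v) by rewrite /S /= fg.
congr (g _); rewrite -[S v]mul_rV_lin1 -/M -{3}(mulmx_ebase M) rM !mulmxA.
have -> : pid_mx k = row_mx 1%:M 0 :> 'M[R]_(k, k + d) by rewrite pid_mx_row.
by rewrite mul_mx_row mulmx1 mulmx0.
Qed.

(** The norm of [H] in the coordinates [b], rounded on the integer grid: countably
    many codes describe all spaces up to small distortion. *)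
Definition norm_code n (H : fdNormed R) (b : {linear 'rV[R]_n -> H}) r : seq nat :=
  [seq Num.truncn `|b (grid_row g)| | g <- enum {: {ffun 'I_n -> 'I_r.*2.+1}}].

Lemma norm_code_eq n (H H' : fdNormed R) (b : {linear 'rV[R]_n -> H})
    (b' : {linear 'rV[R]_n -> H'}) r (g : {ffun 'I_n -> 'I_r.*2.+1}) :
  norm_code b r = norm_code b' r -> `| `|b (grid_row g)| - `|b' (grid_row g)| | <= 1.
Proof.
move=> /eq_in_map /(_ g); rewrite mem_enum => /(_ isT) e.
have /truncn_itv := normr_ge0 (b (grid_row g)).
have /truncn_itv := normr_ge0 (b' (grid_row g)).
rewrite e; set k := Num.truncn _; rewrite -natr1 ler_norml => /andP[? ?] /andP[? ?].
by apply/andP; split; lra.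
Qed.

(** Choose one member of [K], extending [F], for each code that occurs. Two extensions
    with the same code have coordinates that agree on [F], so that the change of
    coordinates commutes exactly with the two maps from [F]. *)
Theorem countable_extensions (K : fdNormed R -> Prop) (F : fdNormed R) : K F ->
  exists (G : nat -> fdNormed R) (psi : forall j, {linear F -> G j}),
    (forall j, K (G j)) /\
    forall (H : fdNormed R) (chi : {linear F -> H}) eta,
      K H -> injective chi -> 0 < eta ->
      exists j (t : {linear H -> G j}), is_emb eta t /\ forall x, t (chi x) = psi j x.
Proof.
move=> KF; have [k [s [s' s's ss']]] := fd_param (fd_finite_dim F).
(* c consists of the codimension of F, a bound for the norm on the unit cube, the
   size of the grid and the rounded norms *)
pose good (c : nat * (nat * nat * seq nat)) (H : fdNormed R) (chi : {linear F -> H}) :=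
  let: (d, (C, r, w)) := c in K H /\
  exists b : {linear 'rV[R]_(k + d) -> H},
    [/\ forall v, b (row_mx v 0) = chi (s v),
        forall v, `|b v| <= C%:R * `|v| & norm_code b r = w].
have ex j : exists Gpsi : {G : fdNormed R & {linear F -> G}}, K (tag Gpsi) /\
    forall c : nat * (nat * nat * seq nat), unpickle j = Some c ->
      (exists (H : fdNormed R) (chi : {linear F -> H}), good c H chi) ->
      good c (tag Gpsi) (tagged Gpsi).
  have [h|h] := pselect (exists c : nat * (nat * nat * seq nat), unpickle j = Some c /\
      exists (H : fdNormed R) (chi : {linear F -> H}), good c H chi).
    have [c [jc [H [chi hc]]]] := h.
    exists (existT (fun G : fdNormed R => {linear F -> G}) H chi); split.
      by case: c hc {jc} => d [[? ?] ?] [].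
    by move=> c'; rewrite jc => -[<-].
  exists (existT (fun G : fdNormed R => {linear F -> G}) F (idfun : {linear F -> F})).
  by split=> // c jc hc; exfalso; apply: h; exists c.
pose Gp j := projT1 (cid (ex j)).
exists (fun j => tag (Gp j)), (fun j => tagged (Gp j)); split.
  by move=> j; rewrite /Gp; case: cid => ? [].
move=> H chi eta KH chi_inj eta0.
have [|d [b [[b' bb' b'b] hb]]] := @extend_coordinates k H (chi \o s).
  by move=> u v /= /chi_inj /(can_inj s's).
have [c c0 hc] := injective_row_below (can_inj bb').
pose M := \sum_i `|b (delta_mx 0 i)|.
have M0 : 0 <= M by apply: sumr_ge0.
pose C := (Num.truncn M).+1.
have MC : M <= C%:R by apply/ltW/truncnS_gt.
set e := 1 - expR (- eta); have e0 : 0 < e by exact: one_sub_expRN_gt0.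
pose r := (Num.truncn ((1 + 2 * C%:R) / (e * c))).+1.
have rP : (1 + 2 * C%:R) / r%:R <= e * c.
  rewrite ler_pdivrMr ?ltr0n // -ler_pdivrMl ?mulr_gt0 // mulrC.
  by apply: ltW; exact: truncnS_gt.
have bC v : `|b v| <= C%:R * `|v|.
  by apply: (le_trans (linear_row_bounded _ _)); rewrite ler_wpM2r.
pose code := (d, (C, r, norm_code b r)); pose j := pickle code.
have [_ hj] := projT2 (cid (ex j)).
have [] := hj code (pickleK code).
  by exists H, chi; split=> //; exists b.
rewrite -/(Gp j) => _ [bj [hbj bjC codej]].
have lb' : linear b' by move=> a x y; rewrite -{1}(b'b x) -{1}(b'b y) -linearP bb'.
exists j, (bj \o mklin lb'); split=> [|x].
  apply: near_isometry_emb => y /=; rewrite -/e -{2 3}(b'b y).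
  have := @grid_close _ _ r (lin_seminorm bj) (lin_seminorm b) C%:R 1 _ bjC bC.
  move=> close; apply: le_trans (close _ _ _) _ => //.
    by move=> g; exact: norm_code_eq codej.
  apply: (@le_trans _ _ (e * c * `|b' y|)); first by rewrite ler_wpM2r.
  by rewrite -mulrA ler_wpM2l // ltW.
by rewrite /= -{1}(ss' x) -[chi _]/((chi \o s) (s' x)) -hb bb' hbj ss'.
Qed.

End Separability.

(** * The Fraisse sequence of a guarded class *)

Section FraisseSequence.
Context {R : realType}.
Variable K : fdNormed R -> Prop.
Hypothesis KP : guarded_fraisse_class K.

(** The conclusion of the guarded amalgamation property for [phi], with a bound at
    each vector. *)
Definition gapped (E F : fdNormed R) (phi : {linear E -> F}) (d c : R) : Prop :=
  forall (G H : fdNormed R) (psiG : {linear F -> G}) (psiH : {linear F -> H}),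
    K G -> K H -> is_emb d psiG -> is_emb d psiH ->
    exists (L : fdNormed R) (i : {linear G -> L}) (j : {linear H -> L}),
      [/\ K L, is_emb 0 i, is_emb 0 j &
        forall x, `|i (psiG (phi x)) - j (psiH (phi x))| <= c * `|x|].

Lemma gap_exists (E : fdNormed R) e : K E -> 0 < e ->
  exists (F : fdNormed R) (phi : {linear E -> F}) (d : R),
    [/\ K F, is_emb e phi, 0 < d & gapped phi d e].
Proof.
move=> KE e0; have [F [phi [d [KF hphi d0 h]]]] := gfc_GAP KP KE e0.
exists F, phi, d; split=> // G H psiG psiH KG KH hG hH.
have [L [i [j [KL hi hj]]]] := h G H psiG psiH KG KH hG hH.
set f := (X in opnorm X) => hf; exists L, i, j; split=> // x.
have lf : linear f := linearP ((i \o (psiG \o phi)) \- (j \o (psiH \o phi))).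
have fb y : `|f y| <= (expR (0 + (d + e)) + expR (0 + (d + e))) * `|y|.
  apply: le_trans (ler_normB _ _) _; rewrite mulrDl lerD //.
    exact: (emb_ub y (emb_comp hi (emb_comp hG hphi))).
  exact: (emb_ub y (emb_comp hj (emb_comp hH hphi))).
by apply: (le_trans (opnorm_ub x lf fb)); rewrite ler_wpM2r // ltW.
Qed.

(** A guard chosen at an earlier stage, together with its map to the current space
    [F], over which its extension problems are still to be solved. *)
Record hist (F : fdNormed R) := Hist {
  hE : fdNormed R; hF : fdNormed R; hphi : {linear hE -> hF};
  hd : R; hc : R; hq : {linear hF -> F}
}.

Definition hpush (F F' : fdNormed R) (p : {linear F -> F'}) (h : hist F) : hist F' :=
  @Hist F' (hE h) (hF h) (hphi h) (hd h) (hc h) (p \o hq h).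

(** [s] is the slack for the maps still to come: as long as their distortions sum to
    at most [2 * s], the map from [hF h] keeps the distortion that the amalgamation
    property allows. *)
Definition hist_valid (F : fdNormed R) (s : R) (h : hist F) : Prop :=
  [/\ K (hF h), gapped (hphi h) (hd h) (hc h), 0 <= hc h &
      exists c, [/\ 0 <= c, is_emb c (hq h) & c + 2 * s <= hd h]].

(** The history is a total function of the stage; its values at future stages are
    duplicates of a valid guard. *)
Record fstate := FState { fF : fdNormed R; fs : R; fh : nat -> hist fF }.

Definition fvalid (st : fstate) : Prop :=
  [/\ K (fF st), 0 < fs st & forall n, hist_valid (fs st) (fh st n)].

Variable T : forall F : fdNormed R, nat -> {G : fdNormed R & {linear F -> G}}.
Hypothesis TP : forall F, K F -> (forall j, K (tag (T F j))) /\
  forall (H : fdNormed R) (chi : {linear F -> H}) eta,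
    K H -> injective chi -> 0 < eta ->
    exists j (t : {linear H -> tag (T F j)}),
      is_emb eta t /\ forall x, t (chi x) = tagged (T F j) x.

(** The extension number [j] of the guard [hF h] is mapped almost isometrically to the
    next space, compatibly on [hE h] with the maps of the sequence. *)
Definition task_solved (F F' : fdNormed R) (p : {linear F -> F'}) (h : hist F) (j m : nat) :
  Prop := is_emb (hd h) (tagged (T (hF h) j)) ->
    exists2 i : {linear tag (T (hF h) j) -> F'}, is_emb (geo m.+1) i &
      forall x, `|i (tagged (T (hF h) j) (hphi h x)) - p (hq h (hphi h x))|
                <= 2 * hc h * `|x|.

(** Stage [m] treats the problem with the indices [logn 2 m] and [logn 3 m], so that
    each problem is treated infinitely often, with a distortion that tends to 0. *)
Definition fsucc (m : nat) (st st' : fstate) : Prop :=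
  exists p : {linear fF st -> fF st'},
    [/\ is_emb (geo m.+1) p,
        exists d, fh st' m.+1 = @Hist (fF st') (fF st) (fF st') p d (geo m) idfun,
        forall n, n != m.+1 -> fh st' n = hpush p (fh st n) &
        task_solved p (fh st (logn 2 m)) (logn 3 m) m].

Lemma fsucc_init : exists st, fvalid st.
Proof.
have [E KE] := gfc_nonempty KP.
have [F [phi [d [KF hphi' d0 hg]]]] := gap_exists KE ltr01.
exists (@FState F (d / 2) (fun=> @Hist F E F phi d 1 idfun)); split=> //=.
  by rewrite divr_gt0.
move=> _; split=> //=; exists 0; split=> //; first exact/emb0P.
by rewrite add0r mulrC divfK.
Qed.

(** Amalgamate the current space with the extension to be treated, over the earlier
    guard; then guard the amalgam. The new guard is also one for the previous
    space, which embeds isometrically in the amalgam. *)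
Lemma fsucc_step m st : fvalid st -> exists st', fvalid st' /\ fsucc m st st'.
Proof.
case: st => F s h [/= KF s0 hv].
set h0 := h (logn 2 m); set j0 := logn 3 m.
have [KF0 gap0 hc0 [c0 [c0ge hq0 c0le]]] := hv (logn 2 m).
rewrite -/h0 in KF0 gap0 hc0 hq0 c0le.
(* if the extension is too distorted for the guard, there is nothing to solve *)
have [L [i [KL hi hL]]] : exists (L : fdNormed R) (i : {linear F -> L}),
    [/\ K L, is_emb 0 i & is_emb (hd h0) (tagged (T (hF h0) j0)) ->
      exists2 k : {linear tag (T (hF h0) j0) -> L}, is_emb 0 k &
        forall x, `|k (tagged (T (hF h0) j0) (hphi h0 x)) - i (hq h0 (hphi h0 x))|
                  <= hc h0 * `|x|].
  have [psi_emb|] := pselect (is_emb (hd h0) (tagged (T (hF h0) j0))); last first.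
    by move=> nemb; exists F, idfun; split=> //; exact/emb0P.
  have [KT _] := TP KF0.
  have hq0' : is_emb (hd h0) (hq h0) by apply: emb_le hq0; lra.
  have [L [k [i [KL hk hi hki]]]] := gap0 _ _ _ _ (KT j0) KF psi_emb hq0'.
  by exists L, i; split=> // _; exists k.
pose e := Num.min s (geo m.+1).
have e0 : 0 < e by rewrite lt_min s0 geo_gt0.
have e_s : e <= s by rewrite ge_min lexx.
have e_geo : e <= geo m.+1 by rewrite ge_min lexx orbT.
have [F' [phi [d [KF' hphi' d0 hg]]]] := gap_exists KL e0.
pose p : {linear F -> F'} := phi \o i.
have hp : is_emb e p by rewrite -[e]addr0; exact: emb_comp.
have iiso x : `|i x| = `|x| by apply: (emb0P i).1.
pose s' := Num.min (s / 2) (d / 2).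
have s'0 : 0 < s' by rewrite lt_min !divr_gt0.
have s'_s : s' <= s / 2 by rewrite ge_min lexx.
have s'_d : s' <= d / 2 by rewrite ge_min lexx orbT.
pose h' n := if n == m.+1 then @Hist F' F F' p d (geo m) idfun else hpush p (h n).
exists (@FState F' s' h'); split.
  split=> //= n; rewrite /h'; case: eqP => [_|_].
    split=> //=; last 2 first.
    - by rewrite ltW // geo_gt0.
    - by exists 0; split=> //; [exact/emb0P | lra].
    move=> G H psiG psiH KG KH hG hH.
    have [L' [k [l [KL' hk hl hkl]]]] := hg G H psiG psiH KG KH hG hH.
    exists L', k, l; split=> // x; apply: (le_trans (hkl (i x))).
    rewrite iiso ler_wpM2r // (le_trans e_geo) //; exact: geo_decr.
  have [KFn gapn hcn [c [cge hqn cle]]] := hv n.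
  split=> //=; exists (e + c); split; first by rewrite addr_ge0 // ltW.
    exact: emb_comp.
  lra.
exists p; split=> /=; first exact: emb_le hp.
- by exists d; rewrite /h' eqxx.
- by move=> n nm; rewrite /h' (negbTE nm).
move=> /hL [k hk hkx]; exists (phi \o k).
  by apply: emb_le e_geo _; rewrite -[e]addr0; exact: emb_comp.
move=> x; rewrite /= -linearB; apply: (le_trans (emb_ub _ hphi')).
rewrite -mulrA ler_pM ?expR_ge0 // ?hkx //.
apply: expR_le2; apply: (le_trans e_geo).
by rewrite geoS; have := @geo_le1 R m; lra.
Qed.

End FraisseSequence.

(** * Properties of limits of towers *)

Section Realization.
Context {R : realType}.

Lemma emb_cancel (X Y Z : normedModType R) (C D : R) (T : {linear Y -> Z})
    (S : {linear X -> Y}) : is_emb C T -> is_emb D (T \o S) -> is_emb (C + D) S.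
Proof.
move=> hT hS; apply: embP => x; rewrite expRD -mulrA.
  by rewrite (le_trans (emb_lb _ hT)) // ler_wpM2l ?expR_ge0 // (emb_ub x hS).
rewrite mulrCA (le_trans (emb_lb x hS)) // ler_wpM2l ?expR_ge0 //.
exact: emb_ub hT.
Qed.

Section Tower.
Variables (L : nat -> fdNormed R) (p : forall n, {linear L n -> L n.+1}).
Variables (X : normedModType R) (a : forall n, {linear L n -> X}) (C : R).
Hypothesis aX : tower_limit p a C.

(** Rational multiples of the integer grids of the spaces [L n] are dense. *)
Lemma tower_limit_separable : separable X.
Proof.
pose dd n := projT1 (cid (fd_param (fd_finite_dim (L n)))).
have hs n : exists s : {linear 'rV[R]_(dd n) -> L n}, bijective s.
  by rewrite /dd; case: cid.
pose s n := projT1 (cid (hs n)).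
have s_surj n u : exists v, s n v = u.
  by have [t' _ tt'] := projT2 (cid (hs n)); exists (t' u); exact: tt'.
pose D n r k := [set a n (s n ((k%:R / r.+1%:R) *: grid_row g)) |
  g in [set: {ffun 'I_(dd n) -> 'I_r.+1.*2.+1}]].
exists (\bigcup_n \bigcup_r \bigcup_k D n r k).
  apply: bigcup_countable => // n _; apply: bigcup_countable => // r _.
  apply: bigcup_countable => // k _.
  exact: sub_countable (card_image_le _ _) (countableP _).
move=> O [x Ox] Oopen.
have /nbhs_ballP [e /= e0 xO] : nbhs x O by exact: open_nbhs_nbhs.
have e2 : 0 < e / 2 by rewrite divr_gt0.
have [n hn] := tl_dense aX x e2; have [u hu] := hn n (leqnn n).
have [v vu] := s_surj n u.
pose M := \sum_i `|(a n \o s n) (delta_mx 0 i)|.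
have M0 : 0 <= M by apply: sumr_ge0.
pose k := (Num.truncn `|v|).+1.
have vk : `|v| <= k%:R by apply/ltW/truncnS_gt.
have k0 : 0 < k%:R :> R by rewrite ltr0n.
pose r := Num.truncn (M * k%:R / (e / 2)).
have rP : M * k%:R / r.+1%:R < e / 2.
  rewrite ltr_pdivrMr ?ltr0n // -ltr_pdivrMl // mulrC.
  exact: truncnS_gt.
have r0 : 0 < r.+1%:R :> R by rewrite ltr0n.
have [|g hg] := @grid_approx R (dd n) r.+1 (k%:R^-1 *: v).
  by rewrite normrZ normfV gtr0_norm // ler_pdivrMl // mulr1.
exists (a n (s n ((k%:R / r.+1%:R) *: grid_row g))); split; last first.
  by exists n => //; exists r => //; exists k => //; exists g.
apply: xO; rewrite -ball_normE /=.
apply: (le_lt_trans (ler_distD (a n u) _ _)); rewrite [ltRHS]splitr.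
apply: ler_ltD; first by rewrite distrC.
rewrite -vu -!linearB; apply: le_lt_trans rP.
apply: (le_trans (linear_row_bounded (a n \o s n) _)); rewrite -/M -mulrA ler_wpM2l //.
have -> : v - (k%:R / r.+1%:R) *: grid_row g =
    (k%:R / r.+1%:R) *: (r.+1%:R *: (k%:R^-1 *: v) - grid_row g).
  rewrite scalerBr (scalerA (k%:R / r.+1%:R)) divfK ?gt_eqF // scalerA.
  by rewrite mulfV ?gt_eqF // scale1r.
by rewrite normrZ normrM normfV !gtr0_norm // -[leRHS]mulr1 ler_wpM2l.
Qed.

Lemma tower_limit_approx (E : fdNormed R) (e : {linear E -> X}) k : 0 < k ->
  exists N, forall n, (N <= n)%N -> exists t : {linear E -> L n},
    forall x, `|a n (t x) - e x| <= k * `|x|.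
Proof.
move=> k0; have [d [s [s' s's ss']]] := fd_param (fd_finite_dim E).
have [c c0 hc] := injective_row_below (can_inj s's).
pose k' := k * c / d.+1%:R.
have k'0 : 0 < k' by rewrite divr_gt0 ?mulr_gt0 ?ltr0n.
have hi i : exists N, forall n, (N <= n)%N ->
    exists z, `|a n z - e (s (delta_mx 0 i))| <= k'.
  exact: tl_dense aX _ _ k'0.
pose N i := projT1 (cid (hi i)).
exists (\max_i N i) => n Nn.
have hz i : exists z, `|a n z - e (s (delta_mx 0 i))| <= k'.
  have := projT2 (cid (hi i)); apply; apply: leq_trans Nn.
  exact: (leq_bigmax i).
pose z i := projT1 (cid (hz i)).
have ls' : linear s' by move=> r x y; rewrite -{1}(ss' x) -{1}(ss' y) -linearP s's.
exists (lincomb z \o mklin ls') => x; rewrite /= -{2 3}(ss' x); set v := s' x.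
rewrite -[e (s v)]/((e \o s) v) (linear_rowE (e \o s)) !lincombE linear_sum -sumrB.
apply: (le_trans (ler_norm_sum _ _ _)).
apply: (@le_trans _ _ (\sum_(i < d) `|v| * k')).
  apply: ler_sum => i _; rewrite linearZ -scalerBr normrZ.
  by rewrite ler_pM ?row_coord_le //= /z; case: cid.
rewrite sumr_const card_ord -[_ *+ d]mulr_natl.
apply: (@le_trans _ _ (k * (c * `|v|))); last by rewrite ler_wpM2l // ltW.
have kc0 : 0 <= k * c by rewrite mulr_ge0 // ltW.
have dk : d%:R * k' <= k * c.
  rewrite /k' mulrCA -[leRHS]mulr1 ler_wpM2l // ler_pdivrMr ?ltr0n // mul1r.
  by rewrite ler_nat.
by rewrite mulrCA [leRHS]mulrA [leRHS]mulrC ler_wpM2l.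
Qed.

(** A subspace of [X] is nearly contained in the image of each late [L n]: approximate
    the vectors of a basis. *)
Lemma tower_limit_emb (E : fdNormed R) (e : {linear E -> X}) C0 eps : is_emb C0 e -> 0 < eps ->
  exists N, forall n, (N <= n)%N -> exists t : {linear E -> L n},
    is_emb (C0 + eps) t /\ forall x, `|a n (t x) - e x| <= eps * `|e x|.
Proof.
move=> he e0; have [V [S [VS Ssurj]]] := image_subspace e.
have e2 : 0 < eps / 2 by rewrite divr_gt0.
have k0 : 0 < Num.min eps (1 - expR (- (eps / 2))).
  by rewrite lt_min e0 one_sub_expRN_gt0.
have [N1 hN1] := tower_limit_approx (fds_inj V) k0.
have [N2 hN2] := geo_small e2.
exists (maxn N1 N2) => n; rewrite geq_max => /andP[/hN1 [t ht] gn].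
have hat : is_emb (eps / 2) (a n \o t).
  apply: near_isometry_emb => v; rewrite -{2}[`|v|]/(`|fds_inj V v|).
  apply: le_trans (ler_dist_dist _ _) _; apply: (le_trans (ht v)).
  by rewrite ler_wpM2r // ge_min lexx orbT.
have ht2 := emb_cancel (emb_le (hN2 n gn) (tl_emb aX n)) hat.
rewrite -splitr in ht2.
have hS : is_emb C0 S by move=> x; have := he x; rewrite -VS.
exists (t \o S); split; first by rewrite addrC; exact: emb_comp.
move=> x; rewrite -VS /=; apply: (le_trans (ht (S x))).
by rewrite ler_wpM2r // ge_min lexx.
Qed.

End Tower.
End Realization.

(** * The limit of the Fraisse sequence *)

Section Main.
Context {R : realType}.

(** The exponent of 5 is free: it makes [m] as large as desired. *)
Lemma schedule n j N : exists m, [/\ logn 2 m = n, logn 3 m = j & (N <= m)%N].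
Proof.
exists (2 ^ n * 3 ^ j * 5 ^ N)%N.
rewrite !lognM ?muln_gt0 ?expn_gt0 // !lognX !logn_prime //= !muln0 !muln1 !addn0.
split=> //; rewrite (leq_trans (ltnW (ltn_expl N (isT : 1 < 5)%N))) //.
by rewrite leq_pmull // muln_gt0 !expn_gt0.
Qed.

Section Limit.
Variable K : fdNormed R -> Prop.
Hypothesis KP : guarded_fraisse_class K.
Variable T : forall F : fdNormed R, nat -> {G : fdNormed R & {linear F -> G}}.
Hypothesis TP : forall F, K F -> (forall j, K (tag (T F j))) /\
  forall (H : fdNormed R) (chi : {linear F -> H}) eta,
    K H -> injective chi -> 0 < eta ->
    exists j (t : {linear H -> tag (T F j)}),
      is_emb eta t /\ forall x, t (chi x) = tagged (T F j) x.
Variable f : nat -> @fstate R.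
Hypothesis fv : forall n, fvalid K (f n).
Hypothesis fs : forall n, fsucc T n (f n) (f n.+1).

Let L n := fF (f n).
Let p n : {linear L n -> L n.+1} := projT1 (cid (fs n)).

Let pP n : [/\ is_emb (geo n.+1) (p n),
  exists d, fh (f n.+1) n.+1 = @Hist R (L n.+1) (L n) (L n.+1) (p n) d (geo n) idfun,
  forall k, k != n.+1 -> fh (f n.+1) k = hpush (p n) (fh (f n) k) &
  task_solved T (p n) (fh (f n) (logn 2 n)) (logn 3 n) n].
Proof. exact: projT2 (cid (fs n)). Qed.

Lemma frs_emb n : is_emb (geo n.+1) (p n).
Proof. by have [] := pP n. Qed.

Lemma frs_hist n : exists d, 0 < d /\ forall m, (n < m)%N ->
  exists q : {linear L n.+1 -> L m}, (forall z, q z = tmap p m z) /\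
    fh (f m) n.+1 = @Hist R (L m) (L n) (L n.+1) (p n) d (geo n) q.
Proof.
have [_ [d hd] _ _] := pP n; exists d; split.
  have [_ s0 /(_ n.+1)] := fv n.+1; rewrite hd => -[_ _ _ [c [/= c0 _ cd]]]; lra.
elim=> [//|m IH]; rewrite ltnS leq_eqVlt => /predU1P [nm|nm].
  by subst m; exists idfun; split=> // z; rewrite tmap_id.
have [q [hq hm]] := IH nm; have [_ _ push _] := pP m.
exists (p m \o q); split; first by move=> z; rewrite tmapS // -hq.
by rewrite push ?hm // eqSS ltn_eqF.
Qed.

Variables (X : completeNormedModType R) (a : forall n, {linear L n -> X}).
Hypothesis aX : tower_limit p a 0.

Lemma frs_step n m z : (n <= m)%N -> a m (tmap p m z) = a n z.
Proof.
move=> nm; apply/eqP; rewrite -subr_eq0 -normr_le0.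
by have := tl_steps frs_emb aX (lexx 0) z nm; rewrite mulr0 !mul0r.
Qed.

(** The extension [chi] is replaced by a nearby member of the countable family, which
    is treated at stages as late as desired, so that the distortion becomes at most
    [eta]. *)
Lemma frs_extension n : exists2 d, 0 < d &
  forall (H : fdNormed R) (chi : {linear L n.+1 -> H}) eta,
    K H -> is_emb d chi -> 0 < eta ->
    exists2 i : {linear H -> X}, is_emb eta i &
      forall z, `|a n z - i (chi (p n z))| <= 4 * geo n * `|z|.
Proof.
have [d [d0 hist]] := frs_hist n.
exists (d / 2); first by rewrite divr_gt0.
move=> H chi eta KH hchi eta0.
pose eta1 := Num.min (eta / 2) (d / 2).
have eta1_0 : 0 < eta1 by rewrite lt_min !divr_gt0.
have eta1_eta : eta1 <= eta / 2 by rewrite ge_min lexx.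
have eta1_d : eta1 <= d / 2 by rewrite ge_min lexx orbT.
have [KL _ _] := fv n.+1.
have [j [t [ht tchi]]] := (TP KL).2 H chi eta1 KH (emb_inj hchi) eta1_0.
have eta2 : 0 < eta / 2 by rewrite divr_gt0.
have [N hN] := geo_small eta2.
have [m [m2 m3]] := schedule n.+1 j (maxn N n.+1).
rewrite geq_max => /andP[/hN gm nm].
have [q [hq hm]] := hist m nm.
have [_ _ _] := pP m; rewrite m2 m3 hm /task_solved /= => -[|k hk hkx].
  have led : eta1 + d / 2 <= d by lra.
  by move=> x; rewrite -tchi; exact: (emb_le led (emb_comp ht hchi)).
exists (a m.+1 \o (k \o t)).
  have := emb_comp (tl_emb aX m.+1) (emb_comp hk ht).
  by apply: emb_le; rewrite geoS; lra.
move=> z; rewrite /= tchi.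
have -> : a n z = a m.+1 (p m (q (p n z))).
  have -> : p n z = tmap p n.+1 z by rewrite tmapS // tmap_id.
  by rewrite hq tmap_comp // -tmapS ?frs_step // ltnW // ltnW.
rewrite -linearB; apply: (le_trans (emb_ub _ (tl_emb aX m.+1))).
rewrite distrC; apply: (@le_trans _ _ (2 * (2 * geo n * `|z|))); last lra.
rewrite ler_pM ?expR_ge0 // ?hkx //; apply: expR_le2.
by rewrite geoS; have := @geo_le1 R m; lra.
Qed.

(** A member [E] of [K] is embedded jointly with a space of the tower into a member of
    [K], which is mapped to [X] as an extension of that space. *)
Lemma frs_age : age_cl X = K.
Proof.
apply/funext => E; apply/propext; split=> [KE|KE].
  apply: (class_emb (gfc_HP KP) (gfc_closed KP)) => e e0.
  have e2 : 0 < e / 2 by rewrite divr_gt0.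
  have [S hS] := (age_clP X E).1 KE _ e2.
  have [N hN] := tower_limit_emb aX hS e2.
  have [t [ht _]] := hN N (leqnn N).
  by exists (L N), t; split; [have [] := fv N | rewrite [e]splitr].
have [KL _ _] := fv 1.
have [H [KH [i hi] [j hj]]] := gfc_JEP KP KL KE.
apply/age_clP => e e0; have [d d0 hd] := frs_extension 0.
have [k hk _] := hd H i e KH (emb_le (ltW d0) hi) e0.
by exists (k \o j); rewrite -[e]addr0; exact: emb_comp.
Qed.

(** A subspace of [X] is nearly one of a late [L n], and [L n.+1] guards the latter. *)
Lemma frs_gF2 : gF2 X.
Proof.
move=> E eps eps0.
(* the errors e of the approximation and 4 e * 2 of the extension add up to less
   than 12 e *)
pose e := Num.min eps 1 / 24.
have e0 : 0 < e by rewrite divr_gt0 // lt_min eps0 /=.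
have e_eps : 24 * e <= eps by rewrite /e mulrC divfK // ge_min lexx.
have e_1 : 24 * e <= 1 by rewrite /e mulrC divfK // ge_min lexx orbT.
have [N1 hN1] := tower_limit_emb aX (@fds_incl_emb _ _ E) e0.
have [N2 hN2] := geo_small e0.
pose n := maxn N1 N2.
have [t [ht htx]] := hN1 n (leq_maxl _ _).
have gn := hN2 n (leq_maxr _ _).
have [d d0 hd] := frs_extension n.
exists (L n.+1), (p n \o t), d; split=> //.
- by rewrite frs_age; have [] := fv n.+1.
- by apply: emb_le (emb_comp (@frs_emb n) ht); rewrite geoS; lra.
move=> G psi eta; rewrite frs_age => KG hpsi eta0.
have [i hi hix] := hd G psi eta KG hpsi eta0.
exists i; split=> //; apply: (@le_lt_trans _ _ (12 * e)); last by lra.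
apply: opnorm_le => [x|]; last by rewrite mulr_ge0 // ltW.
apply: (le_trans (ler_distD (a n (t x)) _ _)).
have h1 := htx x; rewrite distrC in h1.
have h2 := hix (t x).
have h3 : `|t x| <= 2 * `|x|.
  apply: (le_trans (emb_ub x ht)); rewrite ler_wpM2r //.
  by apply: expR_le2; lra.
have h4 : 4 * geo n * `|t x| <= 4 * e * (2 * `|x|).
  by rewrite ler_pM // ?mulr_ge0 // ?(ltW (geo_gt0 _)) // ler_wpM2l.
have h5 : `|fds_inj E x| = `|x| by [].
rewrite h5 in h1.
have := lerD h1 (le_trans h2 h4) => h6; apply: (le_trans h6).
have x0 := normr_ge0 x; nra.
Qed.

End Limit.

(** Dependent choice along [fsucc_step], then the limit of the resulting tower. *)
Theorem fraisse_limit (K : fdNormed R -> Prop) : guarded_fraisse_class K ->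
  exists X : completeNormedModType R, guarded_fraisse X /\ age_cl X = K.
Proof.
move=> KP.
have exT (F : fdNormed R) : exists T : nat -> {G : fdNormed R & {linear F -> G}},
    K F -> (forall j, K (tag (T j))) /\
    forall (H : fdNormed R) (chi : {linear F -> H}) eta,
      K H -> injective chi -> 0 < eta ->
      exists j (t : {linear H -> tag (T j)}),
        is_emb eta t /\ forall x, t (chi x) = tagged (T j) x.
  have [KF|nKF] := pselect (K F); last first.
    by exists (fun=> existT (fun G : fdNormed R => {linear F -> G}) F
                      (idfun : {linear F -> F})).
  have [G [psi [KG hG]]] := countable_extensions KF.
  by exists (fun j => existT (fun G : fdNormed R => {linear F -> G}) (G j) (psi j)).
pose T F := projT1 (cid (exT F)).
have TP F := projT2 (cid (exT F)).
have [f hf] := dependent_choice_seq (fsucc_init KP)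
  (fun m st => @fsucc_step R K KP T TP m st).
have fv n := (hf n).1; have fs n := (hf n).2.
have [X [a aX]] := tower_limit_exists (frs_emb fs).
exists X; split; last exact (frs_age KP TP fv aX).
split; first exact: tower_limit_separable aX.
by right; exact (frs_gF2 KP TP fv aX).
Qed.

Lemma guarded_gF2 (X : completeNormedModType R) : guarded_fraisse X -> gF2 X.
Proof. by move=> [_ [/gF1_gF2|]]. Qed.

End Main.

Theorem theorem3p9 (R : realType) :
  [/\ forall X : completeNormedModType R,
        guarded_fraisse X -> guarded_fraisse_class (age_cl X),
      forall X Y : completeNormedModType R,
        guarded_fraisse X -> guarded_fraisse Y ->
        (isometric X Y <-> age_cl X = age_cl Y)
    & forall K : fdNormed R -> Prop, guarded_fraisse_class K ->
        exists X : completeNormedModType R, guarded_fraisse X /\ age_cl X = K].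
Proof.
split=> [X /guarded_gF2 gX|X Y gX gY|K KP].
- exact: gF2_class.
- split; first exact: isometric_age_cl.
  by apply: gF2_isometric; [exact: gX.1|exact: gY.1|exact: guarded_gF2..].
- exact: fraisse_limit.
Qed.
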